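(* Let $P,q\in\mathbb C(z)$ be rational functions with $P$ non-constant and $q\not\equiv0$, and let $\gamma\subset\mathbb C$ be a curve containing no poles of $P$ or $q$. Suppose that $q^{-1}\{\infty\}\subseteq P^{-1}\{\infty\}$ (as subsets of $\mathbb{CP}^1$) and $P(\infty)=\infty$. Then the function $I_\infty(t)$ is rational if and only if $I_\infty(t)\equiv0$.
   Context: A curve is an oriented piecewise-smooth curve in $\mathbb C$ (closed or not) having only transversal self-intersections. $U_\infty$ is the connected component of $\mathbb{CP}^1\setminus P(\gamma)$ containing $\infty$, and $I_\infty(t)=\frac{1}{2\pi\sqrt{-1}}\int_\gamma\frac{q(z)\,dz}{P(z)-t}$ for $t\in U_\infty$; it is called rational if it equals a rational function on $U_\infty$. *)

(* Defs.v *)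
From HB Require Import structures.
From mathcomp Require Import all_boot all_order all_algebra complex.
From mathcomp Require Import all_classical all_reals all_analysis.
Set Implicit Arguments.
Unset Strict Implicit.
Unset Printing Implicit Defensive.
Import Order.TTheory GRing.Theory Num.Theory numFieldNormedType.Exports.
Local Open Scope classical_set_scope.
Local Open Scope complex_scope.
Local Open Scope ring_scope.

(* The usual topology of C: [R[i]] as a normed module over itself. *)
#[warnings="-redundant-canonical-projection"]
HB.instance Definition _ (R : rcfType) := NormedModule.copy R[i] (R[i]^o).

Notation "x %:F" := (@FracField.tofrac _ x).

Section RationalFunctions.
Variable K : fieldType.
Implicit Types (f : {fraction {poly K}}) (z : one_point_compactification K).

(* [repr f] is an arbitrary representative of [f], hence the division by the
   gcd: [rnum f / rden f] is [f] in lowest terms. *)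
Definition rnum f : {poly K} :=
  (repr f).1 %/ gcdp (repr f).1 (repr f).2.
Definition rden f : {poly K} :=
  (repr f).2 %/ gcdp (repr f).1 (repr f).2.

Definition rat_eval f (x : K) : K := (rnum f).[x] / (rden f).[x].

(* [f] as a self-map of the projective line, [None] being the point at
   infinity. When [size (rnum f) <= size (rden f)] the value at infinity is the
   quotient of the coefficients of degree [deg (rden f)]. *)
Definition rat_ext f z : one_point_compactification K :=
  match z with
  | Some x => if root (rden f) x then None else Some (rat_eval f x)
  | None => if (size (rden f) < size (rnum f))%N then None
            else Some ((rnum f)`_(size (rden f)).-1 / lead_coef (rden f))
  end.

Lemma rden_neq0 f : rden f != 0.
Proof.
have d0 : (repr f).2 != 0 by exact: denom_ratioP.
by rewrite /rden dvdp_div_eq0 ?dvdp_gcdr.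
Qed.

Lemma coprimep_rnum_rden f : coprimep (rnum f) (rden f).
Proof. by apply: coprimep_div_gcd; rewrite denom_ratioP orbT. Qed.

Lemma rnum_rdenE f : f = (rnum f)%:F / (rden f)%:F.
Proof.
set n := (repr f).1; set d := (repr f).2.
have d0 : d != 0 by exact: denom_ratioP.
have g0 : gcdp n d != 0 by rewrite gcdp_eq0 negb_and d0 orbT.
have fE : f = n%:F / d%:F.
  have dF0 : d%:F != 0 by rewrite tofrac_eq0.
  apply: (mulIf dF0); rewrite mulfVK //; apply/eqP.
  rewrite -[f in f * _]reprK /FracField.tofrac; unlock.
  rewrite -[X in X == _]FracField.pi_mul FracField.equivf_def /FracField.mulf.
  by rewrite !numden_Ratio ?mulf_neq0 ?oner_eq0 // !mulr1 mulrC.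
rewrite [LHS]fE; have gF0 : (gcdp n d)%:F != 0 by rewrite tofrac_eq0.
have -> : n%:F = (rnum f)%:F * (gcdp n d)%:F by rewrite -tofracM divpK ?dvdp_gcdl.
have -> : d%:F = (rden f)%:F * (gcdp n d)%:F by rewrite -tofracM divpK ?dvdp_gcdr.
by rewrite -mulf_div divff // mulr1.
Qed.

End RationalFunctions.

Section Curves.
Variable R : realType.
Local Notation Re := (@complex.Re R).
Local Notation Im := (@complex.Im R).
Implicit Types (a b s t : R) (g : R -> R[i]) (v w : R[i]).

Definition velocity g s : R[i] :=
  derive1 (Re \o g) s +i* derive1 (Im \o g) s.

(* On [[a, b]] the velocity extends continuously, without zeros, to the
   endpoints; by the mean value theorem its values there are the one-sided
   derivatives of [g]. *)
Definition smooth_arc a b g : Prop :=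
  exists v : R -> R[i],
    [/\ {within `[a, b], continuous v},
        (forall s, s \in `[a, b] -> v s != 0) &
        forall s, s \in `]a, b[ ->
          [/\ derivable (Re \o g) s 1, derivable (Im \o g) s 1
            & velocity g s = v s]].

Definition piecewise_smooth a b g : Prop :=
  {within `[a, b], continuous g} /\
  exists2 x : seq R, itv_partition a b x &
    forall i, (i < size x)%N ->
      smooth_arc (nth b (a :: x) i) (nth b (a :: x) i.+1) g.

(* The one-sided tangent vectors at [s]; they are equal unless [s] is a
   corner. *)
Definition tangent_vector a b g s v : Prop :=
  (a < s /\ velocity g t @[t --> s^'-] --> v) \/
  (s < b /\ velocity g t @[t --> s^'+] --> v).

(* The closing up [g a = g b] of a closed curve is not a self-intersection. *)
Definition transversal_self_intersections a b g : Prop :=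
  forall s t, s \in `[a, b] -> t \in `[a, b] -> s < t -> (s, t) <> (a, b) ->
    g s = g t ->
    forall v w, tangent_vector a b g s v -> tangent_vector a b g t w ->
      ~ exists c : R, v = c%:C * w.

Definition is_curve a b g : Prop :=
  [/\ a < b, piecewise_smooth a b g & transversal_self_intersections a b g].

Definition curve_integral (F : R[i] -> R[i]) a b g : R[i] :=
  (\int[lebesgue_measure]_(s in `[a, b]) Re (F (g s) * velocity g s))
  +i*
  (\int[lebesgue_measure]_(s in `[a, b]) Im (F (g s) * velocity g s)).

End Curves.

Section IInfinity.
Variables (R : realType) (P q : {fraction {poly R[i]}}).
Variables (a b : R) (g : R -> R[i]).

Definition U_infty : set (one_point_compactification R[i]) :=
  connected_component (~` [set rat_ext P (Some (g s)) | s in `[a, b]]) None.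

(* At [t = None] the integrand [q / (P - t)] is zero. *)
Definition I_infty (t : one_point_compactification R[i]) : R[i] :=
  if t is Some t then
    (2 * pi%:C * 'i)^-1 *
    curve_integral (fun z => rat_eval q z / (rat_eval P z - t)) a b g
  else 0.

Definition I_infty_rational : Prop :=
  exists r : {fraction {poly R[i]}},
    forall t, U_infty t -> rat_ext r t = Some (I_infty t).

End IInfinity.

(* Main.v *)
(** The statement is reduced to the moments [m_i], the integrals of [P^i q dz].
    Near infinity [I_infty] is a Cauchy transform; multiplying it by the
    denominator [B] of the rational function it equals changes the integrand
    [q / (P - t)] into [B(P) q / (P - t)] up to a polynomial in [t], and decay
    at infinity then forces all the integrals of [P^i B(P) q dz] to vanish.
    It remains to cancel a linear factor [P - t0] of [B(P)], say [t0 = 0]: if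
    [m_i = 0] for [i > 0], then [m_0 = 0].

    Let [O] be the ring of rational functions regular wherever [P] is. As
    [P(oo) = oo], it is generated over [C[P]] by finitely many powers of [z].
    Choose [beta] with [beta(0) <> 0] such that [G = beta(P) P / P'] is in [O]
    and vanishes at both end points of the curve. Integrating by parts, the
    moments of [(G f)'] are [- i] times those of [beta(P) f], so that
    [f |-> (G f)' - c f], [c <> 0], preserves the shape "[m_i = 0] iff
    [i > 0]" of the moments. At a zero of [P] of multiplicity [m], this
    operator with [c = beta(0) (k + 1) / m] (the local exponent, which is
    nonzero) raises the order of vanishing of [f] from [k] to [k + 1].
    Iterating, if [m_0 <> 0] then for every [N] there is [h] in [O] such that
    [P^N h] has moments of this shape, which is impossible for [N] large
    because the [P]-torsion of a finitely generated [C[P]]-module is killed by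
    a fixed power of [P]. *)

Require Import Defs.
From mathcomp Require Import all_boot all_order all_algebra complex.
From mathcomp Require Import all_classical all_reals all_analysis.
From mathcomp Require Import measurable_realfun ring lra zify.
Import Order.TTheory GRing.Theory Num.Theory numFieldNormedType.Exports.
Local Open Scope classical_set_scope.
Local Open Scope complex_scope.
Local Open Scope ring_scope.

Set Implicit Arguments.
Unset Strict Implicit.
Unset Printing Implicit Defensive.

(** * Calculus of rational functions *)

(** The letters ending in 1 stand for derivatives: the quotient rule applied to [(n / d) * (m / e)]
    agrees with the Leibniz rule. *)
Lemma quotient_derivM (F : fieldType) (n n1 d d1 m m1 e e1 : F) :
  d != 0 -> e != 0 ->
  ((n1 * m + n * m1) * (d * e) - n * m * (d1 * e + d * e1)) / (d * e) ^+ 2 =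
  (n1 * d - n * d1) / d ^+ 2 * (m / e) + n / d * ((m1 * e - m * e1) / e ^+ 2).
Proof. by move=> d0 e0; field; rewrite ?d0 ?e0. Qed.

Section RationalFunctionCalculus.
Variable K : fieldType.
Implicit Types (f g : {fraction {poly K}}) (n d p : {poly K}) (x y c : K).

(** As [rden f] is in lowest terms, this is the absence of a pole at [x]. *)
Definition regular f x := ~~ root (rden f) x.

Definition derive_frac f : {fraction {poly K}} :=
  ((rnum f)^`() * rden f - rnum f * (rden f)^`())%:F / ((rden f) ^+ 2)%:F.

Lemma frac_cross f n d : d != 0 -> f = n%:F / d%:F ->
  rnum f * d = n * rden f.
Proof.
move=> d0 fE; apply/eqP; rewrite -tofrac_eq !tofracM.
have dF0 : d%:F != 0 by rewrite tofrac_eq0.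
have rF0 : (rden f)%:F != 0 by rewrite tofrac_eq0 rden_neq0.
by rewrite -(eqr_div _ _ rF0 dF0) -rnum_rdenE fE.
Qed.

(** By cross-multiplication [rden f] divides [rnum f * d], and it is coprime to [rnum f]. *)
Lemma rden_dvd n d : d != 0 -> rden (n%:F / d%:F) %| d.
Proof.
move=> d0; have := frac_cross d0 erefl; set f := _ / _ => e.
have : rden f %| rnum f * d by rewrite e dvdp_mull.
by rewrite Gauss_dvdpr // coprimep_sym coprimep_rnum_rden.
Qed.

Lemma regular_div n d x : d.[x] != 0 -> regular (n%:F / d%:F) x.
Proof.
move=> dx; have d0 : d != 0 by apply: contraNneq dx => ->; rewrite horner0.
apply: contra dx; rewrite -!dvdp_XsubCl => /dvdp_trans/(_ (rden_dvd n d0)).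
by rewrite dvdp_XsubCl.
Qed.

Lemma rat_eval_div n d x : d.[x] != 0 ->
  rat_eval (n%:F / d%:F) x = n.[x] / d.[x].
Proof.
move=> dx; have d0 : d != 0 by apply: contraNneq dx => ->; rewrite horner0.
have := regular_div n dx; rewrite /regular /root /rat_eval => rx.
have /(congr1 (fun p => p.[x])) := frac_cross d0 (erefl (n%:F / d%:F)).
rewrite !hornerM => e; apply: (mulIf dx); rewrite mulfVK //.
by rewrite mulrAC e mulfK.
Qed.

Lemma regularP f x : regular f x ->
  exists n d, f = n%:F / d%:F /\ d.[x] != 0.
Proof. by move=> fx; exists (rnum f), (rden f); rewrite -rnum_rdenE. Qed.

Lemma fracP f : exists n d, f = n%:F / d%:F /\ d != 0.
Proof. by exists (rnum f), (rden f); rewrite -rnum_rdenE rden_neq0. Qed.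

Lemma tofrac_horner_neq0 d x : d.[x] != 0 -> d%:F != 0.
Proof.
by move=> dx; rewrite tofrac_eq0; apply: contraNneq dx => ->; rewrite horner0.
Qed.

Lemma tofrac_div1 p : p%:F = p%:F / 1%:F.
Proof. by rewrite tofrac1 divr1. Qed.

Lemma regular_poly p x : regular p%:F x.
Proof. by rewrite tofrac_div1 regular_div // hornerC oner_neq0. Qed.

Lemma rat_eval_poly p x : rat_eval p%:F x = p.[x].
Proof. by rewrite tofrac_div1 rat_eval_div hornerC ?oner_neq0 // divr1. Qed.

Lemma addf_frac f g n d n' d' : d%:F != 0 -> d'%:F != 0 ->
  f = n%:F / d%:F -> g = n'%:F / d'%:F ->
  f + g = (n * d' + n' * d)%:F / (d * d')%:F.
Proof.
by move=> d0 d'0 -> ->; rewrite (addf_div _ _ d0 d'0) tofracD !tofracM.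
Qed.

Lemma mulf_frac f g n d n' d' :
  f = n%:F / d%:F -> g = n'%:F / d'%:F ->
  f * g = (n * n')%:F / (d * d')%:F.
Proof. by move=> -> ->; rewrite !tofracM invfM mulrACA. Qed.

Lemma regularD f g x : regular f x -> regular g x -> regular (f + g) x.
Proof.
move=> /regularP[n [d [fE dx]]] /regularP[n' [d' [gE d'x]]].
rewrite (addf_frac (tofrac_horner_neq0 dx) (tofrac_horner_neq0 d'x) fE gE).
by apply: regular_div; rewrite hornerM mulf_neq0.
Qed.

Lemma rat_evalD f g x : regular f x -> regular g x ->
  rat_eval (f + g) x = rat_eval f x + rat_eval g x.
Proof.
move=> /regularP[n [d [fE dx]]] /regularP[n' [d' [gE d'x]]].
rewrite (addf_frac (tofrac_horner_neq0 dx) (tofrac_horner_neq0 d'x) fE gE).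
rewrite fE gE (rat_eval_div _ dx) (rat_eval_div _ d'x) rat_eval_div hornerM.
  by rewrite hornerD !hornerM addf_div.
exact: mulf_neq0.
Qed.

Lemma regularM f g x : regular f x -> regular g x -> regular (f * g) x.
Proof.
move=> /regularP[n [d [fE dx]]] /regularP[n' [d' [gE d'x]]].
by rewrite (mulf_frac fE gE); apply: regular_div; rewrite hornerM mulf_neq0.
Qed.

Lemma rat_evalM f g x : regular f x -> regular g x ->
  rat_eval (f * g) x = rat_eval f x * rat_eval g x.
Proof.
move=> /regularP[n [d [fE dx]]] /regularP[n' [d' [gE d'x]]].
rewrite (mulf_frac fE gE) fE gE (rat_eval_div _ dx) (rat_eval_div _ d'x).
by rewrite rat_eval_div !hornerM; [rewrite invfM mulrACA|exact: mulf_neq0].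
Qed.

Lemma regularV f x : regular f x -> rat_eval f x != 0 -> regular f^-1 x.
Proof.
move=> /regularP[n [d [-> dx]]]; rewrite rat_eval_div // mulf_eq0 negb_or.
by case/andP=> nx _; rewrite invf_div regular_div.
Qed.

Lemma rat_evalV f x : regular f x -> rat_eval f x != 0 ->
  rat_eval f^-1 x = (rat_eval f x)^-1.
Proof.
move=> /regularP[n [d [-> dx]]]; rewrite rat_eval_div // mulf_eq0 negb_or.
by case/andP=> nx _; rewrite invf_div rat_eval_div // invf_div.
Qed.

Lemma regularX f x i : regular f x -> regular (f ^+ i) x.
Proof.
move=> fx; elim: i => [|i IHi]; first by rewrite expr0 -tofrac1 regular_poly.
by rewrite exprS regularM.
Qed.

Lemma regular_factor f x : regular f x -> rat_eval f x = 0 ->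
  exists2 g, regular g x & f = ('X - x%:P)%:F * g.
Proof.
move=> /regularP[n [d [-> dx]]]; rewrite rat_eval_div // => /eqP.
rewrite mulf_eq0 invr_eq0 (negbTE dx) orbF => /factor_theorem[p ->].
exists (p%:F / d%:F); first exact: regular_div.
by rewrite [p * _]mulrC tofracM mulrA.
Qed.

(** Independence of the representative, obtained by differentiating the cross relation
    [rnum f * d = n * rden f]. *)
Lemma derive_frac_div n d : d != 0 ->
  derive_frac (n%:F / d%:F) = (n^`() * d - n * d^`())%:F / (d ^+ 2)%:F.
Proof.
move=> d0; set f := _ / _; have /= e := frac_cross d0 (erefl f).
have := congr1 (fun p => p^`()) e; rewrite !derivM => /esym de.
have r0 := rden_neq0 f.
have dF0 : d%:F != 0 by rewrite tofrac_eq0.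
have rF0 : (rden f)%:F != 0 by rewrite tofrac_eq0.
rewrite /derive_frac; set N := rnum f in e de *; set D := rden f in e de r0 rF0 *.
suff E : (N^`() * D - N * D^`()) * d ^+ 2 = (n^`() * d - n * d^`()) * D ^+ 2.
  rewrite !tofracXn; apply/eqP.
  rewrite (eqr_div _ _ (expf_neq0 2 rF0) (expf_neq0 2 dF0)).
  by rewrite -!tofracXn -!tofracM E.
(* Arranged so that [N] enters only through [N * d] and its derivative. *)
have -> : (N^`() * D - N * D^`()) * d ^+ 2 =
  (N^`() * d + N * d^`()) * d * D - (N * d) * (d^`() * D + d * D^`()) by ring.
by rewrite e -de; ring.
Qed.

Lemma derive_frac_poly p : derive_frac p%:F = (p^`())%:F.
Proof.
rewrite tofrac_div1 derive_frac_div ?oner_neq0 // derivC mulr0 subr0 mulr1.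
by rewrite expr1n tofrac1 divr1.
Qed.

Lemma regular_derive f x : regular f x -> regular (derive_frac f) x.
Proof.
move=> /regularP[n [d [-> dx]]]; rewrite derive_frac_div.
  by apply: regular_div; rewrite horner_exp; exact: expf_neq0.
by apply: contraNneq dx => ->; rewrite horner0.
Qed.

Lemma derive_fracM f g :
  derive_frac (f * g) = derive_frac f * g + f * derive_frac g.
Proof.
have [n [d [-> d0]]] := fracP f; have [n' [d' [-> d'0]]] := fracP g.
rewrite (mulf_frac erefl erefl) !derive_frac_div ?mulf_neq0 // !derivM.
have dF0 : d%:F != 0 by rewrite tofrac_eq0.
have d'F0 : d'%:F != 0 by rewrite tofrac_eq0.
rewrite !tofracXn !(tofracM, tofracB, tofracD).
exact: (quotient_derivM _ _ _ _ _ _ dF0 d'F0).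
Qed.

Lemma derive_frac1 : derive_frac 1 = 0.
Proof. by rewrite -tofrac1 derive_frac_poly derivC tofrac0. Qed.

Lemma derive_fracX f i : derive_frac (f ^+ i) = i%:R * f ^+ i.-1 * derive_frac f.
Proof.
elim: i => [|[|i] IHi]; first by rewrite expr0 derive_frac1 !mul0r.
  by rewrite expr1 expr0 !mul1r.
rewrite exprS derive_fracM IHi /= [in i.+2%:R]mulrS !exprS; ring.
Qed.

End RationalFunctionCalculus.

(** * The ring of functions regular off the poles of P *)

Section PolynomialsInP.
Variables (K : fieldType) (P : {fraction {poly K}}).
Implicit Types (f g : {fraction {poly K}}) (a p : {poly K}) (x y c : K).

Definition const_frac c : {fraction {poly K}} := c%:P%:F.

Definition poly_at a : {fraction {poly K}} :=
  (map_poly (@FracField.tofrac {poly K} \o polyC) a).[P].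

Lemma poly_atD a a' : poly_at (a + a') = poly_at a + poly_at a'.
Proof. by rewrite /poly_at rmorphD hornerD. Qed.

Lemma poly_atM a a' : poly_at (a * a') = poly_at a * poly_at a'.
Proof. by rewrite /poly_at rmorphM hornerM. Qed.

Lemma poly_atC c : poly_at c%:P = const_frac c.
Proof. by rewrite /poly_at map_polyC hornerC. Qed.

Lemma poly_atX : poly_at 'X = P.
Proof. by rewrite /poly_at map_polyX hornerX. Qed.

Lemma poly_at0 : poly_at 0 = 0.
Proof. by rewrite /poly_at rmorph0 horner0. Qed.

Lemma poly_at1 : poly_at 1 = 1.
Proof. by rewrite /poly_at rmorph1 hornerC. Qed.

Lemma poly_atN a : poly_at (- a) = - poly_at a.
Proof. by rewrite /poly_at rmorphN hornerN. Qed.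

Lemma poly_atXn i : poly_at ('X^i) = P ^+ i.
Proof.
elim: i => [|i IHi]; first by rewrite !expr0 poly_at1.
by rewrite !exprS poly_atM IHi poly_atX.
Qed.

Lemma poly_at_regular a x : regular P x -> regular (poly_at a) x.
Proof.
move=> Px; elim/poly_ind: a => [|a c IHa].
  by rewrite poly_at0 -tofrac0 regular_poly.
rewrite poly_atD poly_atM poly_atX poly_atC.
by apply: regularD; [exact: regularM|exact: regular_poly].
Qed.

Lemma rat_eval_poly_at a x : regular P x ->
  rat_eval (poly_at a) x = a.[rat_eval P x].
Proof.
move=> Px; elim/poly_ind: a => [|a c IHa].
  by rewrite poly_at0 -tofrac0 rat_eval_poly !horner0.
rewrite poly_atD poly_atM poly_atX poly_atC.
have ax := poly_at_regular a Px.
rewrite (rat_evalD (regularM ax Px) (regular_poly _ _)) (rat_evalM ax Px) IHa.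
by rewrite rat_eval_poly hornerMXaddC hornerC.
Qed.

(** The ring O of the overview. Infinity is not tested, so O contains all polynomials in the
    variable. *)
Definition regular_off_poles f := forall x, regular P x -> regular f x.

Lemma regular_off_polesD f g :
  regular_off_poles f -> regular_off_poles g -> regular_off_poles (f + g).
Proof. by move=> hf hg x Px; apply: regularD; [exact: hf|exact: hg]. Qed.

Lemma regular_off_polesM f g :
  regular_off_poles f -> regular_off_poles g -> regular_off_poles (f * g).
Proof. by move=> hf hg x Px; apply: regularM; [exact: hf|exact: hg]. Qed.

Lemma regular_off_poles_poly p : regular_off_poles p%:F.
Proof. by move=> x _; exact: regular_poly. Qed.

Lemma regular_off_poles_at a : regular_off_poles (poly_at a).
Proof. by move=> x; exact: poly_at_regular. Qed.

Lemma regular_off_polesX i : regular_off_poles (P ^+ i).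
Proof. by move=> x; exact: regularX. Qed.

Lemma regular_off_poles_derive f :
  regular_off_poles f -> regular_off_poles (derive_frac f).
Proof. by move=> hf x Px; apply: regular_derive; exact: hf. Qed.

(** The [K[P]]-module spanned by the powers of the variable with exponent below [n], built so that
    the coefficient of the highest power can be split off. *)
Fixpoint polyspan n f : Prop :=
  if n is n'.+1 then
    exists f' a, polyspan n' f' /\ f = f' + poly_at a * 'X%:F ^+ n'
  else f = 0.

Lemma polyspanD n f g : polyspan n f -> polyspan n g -> polyspan n (f + g).
Proof.
elim: n f g => [|n IHn] f g /=; first by move=> -> ->; rewrite addr0.
move=> [f' [a [sf ->]]] [g' [b [sg ->]]].
exists (f' + g'), (a + b); split; first exact: IHn.
by rewrite poly_atD mulrDl addrACA.
Qed.

Lemma polyspanZ n a f : polyspan n f -> polyspan n (poly_at a * f).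
Proof.
elim: n f => [|n IHn] f /=; first by move=> ->; rewrite mulr0.
move=> [f' [b [sf ->]]]; exists (poly_at a * f'), (a * b).
by split; [exact: IHn|rewrite poly_atM mulrDr mulrA].
Qed.

Lemma polyspan0 n : polyspan n 0.
Proof.
elim: n => [//|n IHn]; exists 0, 0; split; first exact: IHn.
by rewrite poly_at0 mul0r addr0.
Qed.

Lemma polyspan_Xn n i : (i < n)%N -> polyspan n ('X%:F ^+ i).
Proof.
elim: n => [//|n IHn]; rewrite ltnS leq_eqVlt => /orP[/eqP->|/IHn s].
  exists 0, 1; split; first exact: polyspan0.
  by rewrite poly_at1 mul1r add0r.
by exists ('X%:F ^+ i), 0; split; [exact: s|rewrite poly_at0 mul0r addr0].
Qed.

Lemma polyspan_poly n p : (size p <= n)%N -> polyspan n p%:F.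
Proof.
move=> pn; have -> : p = \poly_(i < n) p`_i.
  apply/polyP => i; rewrite coef_poly; case: ltnP => // ni.
  by rewrite nth_default // (leq_trans pn ni).
rewrite poly_def raddf_sum /=.
apply: big_ind => [|f g|i _]; [exact: polyspan0|exact: polyspanD|].
rewrite -mul_polyC tofracM -/(const_frac _) -poly_atC tofracXn.
by apply: polyspanZ; exact: polyspan_Xn.
Qed.

Section FiniteMap.
Hypothesis P_infty : (size (rden P) < size (rnum P))%N.
Let n := (size (rnum P)).-1.

Let size_rnum : size (rnum P) = n.+1.
Proof. by rewrite prednK // (leq_ltn_trans _ P_infty). Qed.

Let rnumE : (rnum P)%:F = P * (rden P)%:F.
Proof.
rewrite [X in _ = X * _](rnum_rdenE P) mulfVK ?tofrac_eq0 //; exact: rden_neq0.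
Qed.

(** The relation [rnum P = P * rden P] is an equation of degree [n] for the variable over [K[P]]. As
    [rden P] has smaller degree, the leading coefficient is a nonzero constant, so the variable is
    integral over [K[P]]. *)
Lemma polyspan_lead : polyspan n ('X%:F ^+ n).
Proof.
have l0 : lead_coef (rnum P) != 0 by rewrite lead_coef_eq0 -size_poly_gt0 size_rnum.
set l := lead_coef _ in l0.
have -> : 'X%:F ^+ n = poly_at (l^-1)%:P *
    (poly_at 'X * (rden P)%:F + (l *: 'X^n - rnum P)%:F).
  rewrite poly_atX -rnumE poly_atC -tofracD addrC subrK -tofracXn -tofracM.
  by rewrite mul_polyC scalerA mulVf // scale1r.
apply: polyspanZ; apply: polyspanD.
  by apply: polyspanZ; apply: polyspan_poly; rewrite -ltnS -size_rnum.
apply: polyspan_poly; apply/leq_sizeP => j; rewrite leq_eqVlt.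
rewrite coefB coefZ coefXn => /orP[/eqP <-|nj].
  by rewrite eqxx mulr1 /l lead_coefE subrr.
by rewrite (gtn_eqF nj) mulr0 sub0r nth_default ?oppr0 // size_rnum.
Qed.

(** Only the highest power leaves the range, and [polyspan_lead] brings it back. *)
Lemma polyspan_mulX f : polyspan n f -> polyspan n ('X%:F * f).
Proof.
suff H m : (m <= n)%N -> forall f, polyspan m f -> polyspan n ('X%:F * f).
  exact: (H n (leqnn n)).
elim: m => [|m IHm] mn {}f /=; first by move=> ->; rewrite mulr0; exact: polyspan0.
move=> [f' [a [sf ->]]]; rewrite mulrDr mulrCA -exprS.
apply: polyspanD; first exact: (IHm (ltnW mn) _ sf).
apply: polyspanZ; move: mn; rewrite leq_eqVlt => /orP[/eqP->|]; first exact: polyspan_lead.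
exact: polyspan_Xn.
Qed.

Lemma polyspan_mul_poly p f : polyspan n f -> polyspan n (p%:F * f).
Proof.
move=> sf; elim/poly_ind: p => [|p c IHp].
  by rewrite tofrac0 mul0r; exact: polyspan0.
rewrite tofracD tofracM mulrDl -/(const_frac c) -poly_atC.
apply: polyspanD; last exact: polyspanZ.
by rewrite mulrAC mulrC; exact: polyspan_mulX.
Qed.

(* Bezout turns [1 / rden P] into a polynomial in [P] and the variable. *)
Lemma polyspan_div_rden k f : polyspan n f -> polyspan n (f / (rden P)%:F ^+ k).
Proof.
move=> sf; elim: k => [|k IHk]; first by rewrite expr0 divr1.
have /Bezout_eq1_coprimepP[[u v] /= uv] := coprimep_rnum_rden P.
have dV : (rden P)%:F^-1 = P * u%:F + v%:F.
  have d0 : (rden P)%:F != 0 by rewrite tofrac_eq0 rden_neq0.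
  apply: (mulIf d0); rewrite (mulVf d0) -tofrac1 -uv tofracD !tofracM rnumE.
  by rewrite mulrDl mulrCA mulrA mulrAC.
rewrite exprSr invfM mulrA dV mulrC mulrDl -mulrA -{1}poly_atX.
apply: polyspanD; last exact: polyspan_mul_poly.
by apply: polyspanZ; exact: polyspan_mul_poly.
Qed.

End FiniteMap.

(** The torsion modulo the submodule [W] is finitely generated because [K[P]] is a principal ideal
    ring. The induction on the number of generators uses the ideal of leading coefficients of
    torsion elements. *)
Lemma stable_exponent (W : {fraction {poly K}} -> Prop) n :
  (forall f g, W f -> W g -> W (f + g)) ->
  (forall a f, W f -> W (poly_at a * f)) ->
  exists N, forall f, polyspan n f -> (exists k, W (P ^+ k * f)) -> W (P ^+ N * f).
Proof.
move=> WD WZ; pose T f := exists k, W (P ^+ k * f).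
have Wle f k N : (k <= N)%N -> W (P ^+ k * f) -> W (P ^+ N * f).
  by move=> /subnK <- Wf; rewrite exprD -mulrA -poly_atXn; exact: WZ.
have TZ a f : T f -> T (poly_at a * f).
  by move=> [k Wf]; exists k; rewrite mulrCA; exact: WZ.
have TD f g : T f -> T g -> T (f + g).
  move=> [k Wf] [l Wg]; exists (maxn k l); rewrite mulrDr.
  by apply: WD; [apply: Wle Wf; exact: leq_maxl|apply: Wle Wg; exact: leq_maxr].
elim: n => [|n [N HN]].
  by exists 0%N => f /= -> [k]; rewrite !mulr0.
(* The coefficients of the highest power in torsion elements. *)
pose I d := exists g', polyspan n g' /\ T (g' + poly_at d * 'X%:F ^+ n).
have [[d0 [d0_neq0 Id0]]|noI] := pselect (exists d, d != 0 /\ I d); last first.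
  (* If all these coefficients are zero, the torsion lies in the shorter span. *)
  exists N => f [f' [a [sf' fE]]] Tf.
  have [a0|a0] := eqVneq a 0.
    by apply: HN Tf; rewrite fE a0 poly_at0 mul0r addr0.
  by case: noI; exists a; split; [exact: a0|exists f'; rewrite -fE].
(* A nonzero coefficient [d] of minimal size generates the ideal; [g] is a torsion element that has
   it. *)
have exQ : exists m, `[< exists d, [/\ d != 0, I d & size d = m] >].
  by exists (size d0); apply/asboolP; exists d0.
case: (ex_minnP exQ) => m /asboolP[d [dn0 [g' [sg' Tg]] dm]] mmin.
set g := g' + _ in Tg; case: (Tg) => k Wg.
exists (maxn N k) => f [f' [a [sf' fE]]] Tf.
have aE : a = a %/ d * d + a %% d by exact: divp_eq.
(* Subtracting a multiple of [g] leaves the remainder [a %% d] as highest coefficient, and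
   minimality of [d] makes it zero. *)
have fE' : f + poly_at (- (a %/ d)) * g =
    (f' + poly_at (- (a %/ d)) * g') + poly_at (a %% d) * 'X%:F ^+ n.
  rewrite fE /g [in poly_at a]aE poly_atD poly_atM poly_atN; ring.
have sr : polyspan n (f' + poly_at (- (a %/ d)) * g').
  by apply: polyspanD; [exact: sf'|exact: polyspanZ].
have Tr : T (f + poly_at (- (a %/ d)) * g) by apply: TD; [exact: Tf|exact: TZ].
have r0 : a %% d = 0.
  apply/eqP; apply: contraT => r0.
  have /mmin : `[< exists e, [/\ e != 0, I e & size e = size (a %% d)] >].
    apply/asboolP; exists (a %% d); split; [exact: r0| |exact: erefl].
    by exists (f' + poly_at (- (a %/ d)) * g'); rewrite -fE'.
  by rewrite -dm leqNgt ltn_modp dn0.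
rewrite r0 poly_at0 mul0r addr0 in fE'; rewrite -fE' in sr.
have -> : f = (f + poly_at (- (a %/ d)) * g) + poly_at (a %/ d) * g.
  by rewrite poly_atN mulNr subrK.
rewrite mulrDr; apply: WD; first by apply: Wle (HN _ sr Tr); exact: leq_maxl.
by rewrite mulrCA; apply: WZ; apply: Wle Wg; exact: leq_maxr.
Qed.

End PolynomialsInP.

(** * Orders of vanishing at the zeros of P *)

Section OrderOfVanishing.
Variables (K : numFieldType) (P : {fraction {poly K}}).
Implicit Types (f g w : {fraction {poly K}}) (x y c : K).

(** Vanishing to order at least [k]. *)
Definition vanishes x k f := exists2 f1, regular f1 x & f = ('X - x%:P)%:F ^+ k * f1.

Lemma zero_factor x : P != 0 -> regular P x -> rat_eval P x = 0 ->
  exists m p, [/\ regular p x, rat_eval p x != 0 & P = ('X - x%:P)%:F ^+ m.+1 * p].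
Proof.
move=> P0 Px ex.
have n0 : rnum P != 0.
  by apply: contra_neq P0 => n0; rewrite (rnum_rdenE P) n0 tofrac0 mul0r.
have [m [r]] := multiplicity_XsubC (rnum P) x; rewrite n0 /= => rx nE.
have PE : P = ('X - x%:P)%:F ^+ m * (r%:F / (rden P)%:F).
  by rewrite [LHS](rnum_rdenE P) nE tofracM tofracXn mulrA [r%:F * _]mulrC.
have px : rat_eval (r%:F / (rden P)%:F) x != 0.
  by rewrite (rat_eval_div _ Px) mulf_neq0 // invr_eq0.
(* Multiplicity zero would make [P] nonzero at [x]. *)
case: m => [|m] in PE nE *; last first.
  by exists m, (r%:F / (rden P)%:F); split; [exact: regular_div|exact: px|].
by move: px; rewrite expr0 mul1r in PE; rewrite -PE ex eqxx.
Qed.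

(* The multiplicity of the zero is the residue of [P' / P], of which [w] is an inverse. *)
Lemma log_derivative_local (beta : {poly K}) m p x :
    regular P x -> rat_eval P x = 0 -> regular p x -> rat_eval p x != 0 ->
    P = ('X - x%:P)%:F ^+ m.+1 * p ->
  exists w, [/\ regular w x, rat_eval w x = beta.[0] / m.+1%:R &
    poly_at P beta * P / derive_frac P = ('X - x%:P)%:F * w].
Proof.
move=> Px ex px px0 PE; set z := ('X - x%:P)%:F.
pose v := m.+1%:R * p + z * derive_frac p.
have zx : regular z x by exact: regular_poly.
have z0 : z != 0 by rewrite tofrac_eq0 polyXsubC_eq0.
have z'E : derive_frac z = 1 by rewrite derive_frac_poly derivXsubC tofrac1.
(* One order is lost by differentiation; the cofactor [v] is a unit at [x] because the multiplicity
   is nonzero in characteristic zero. *)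
have dP : derive_frac P = z ^+ m * v.
  by rewrite PE derive_fracM derive_fracX -/z z'E /v /= [z ^+ m.+1]exprS; ring.
have mE : m.+1%:R = const_frac m.+1%:R :> {fraction {poly K}}.
  by rewrite /const_frac !rmorph_nat.
have zv0 : rat_eval z x = 0 by rewrite rat_eval_poly hornerXsubC subrr.
have r1 : regular (m.+1%:R * p) x.
  by rewrite mE; apply: regularM px; exact: regular_poly.
have r2 : regular (z * derive_frac p) x.
  by apply: regularM zx _; exact: regular_derive.
have vx : regular v x by exact: regularD.
have evv : rat_eval v x = m.+1%:R * rat_eval p x.
  rewrite (rat_evalD r1 r2) (rat_evalM zx (regular_derive px)) zv0 mul0r addr0.
  by rewrite mE (rat_evalM (regular_poly _ _) px) rat_eval_poly hornerC.
have ev0 : rat_eval v x != 0 by rewrite evv mulf_neq0 // pnatr_eq0.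
have bx := poly_at_regular beta Px.
have vVx := regularV vx ev0.
exists (poly_at P beta * p / v); split.
- by apply: regularM vVx; exact: regularM.
- rewrite (rat_evalM (regularM bx px) vVx) (rat_evalM bx px) (rat_evalV vx ev0).
  rewrite (rat_eval_poly_at _ Px) ex evv invfM mulrACA mulrA -[RHS]mulr1.
  by rewrite -[_ * rat_eval p x / _]mulrA mulfV // mulr1.
rewrite dP [X in _ * X / _]PE -/z exprS invfM.
have zm0 : z ^+ m != 0 by exact: expf_neq0.
set u := z ^+ m in zm0 *; set b := poly_at P beta.
have -> : b * (z * u * p) * (u^-1 * v^-1) = u / u * (z * (b * p / v)) by ring.
by rewrite (mulfV zm0) mul1r.
Qed.

(** On functions of order [k] the operator multiplies the leading coefficient by
    [k.+1%:R * rat_eval w x - c]. Any [c] keeps the order; the root of this expression raises it. *)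
Lemma vanishes_step G w x k f c :
    regular w x -> G = ('X - x%:P)%:F * w -> vanishes x k f ->
  vanishes x k (derive_frac (G * f) - const_frac c * f) /\
  (c = k.+1%:R * rat_eval w x ->
    vanishes x k.+1 (derive_frac (G * f) - const_frac c * f)).
Proof.
move=> wx -> [f1 f1x ->]; set z := ('X - x%:P)%:F.
have zx : regular z x by exact: regular_poly.
have z'E : derive_frac z = 1 by rewrite derive_frac_poly derivXsubC tofrac1.
have wf : regular (w * f1) x by exact: regularM.
have kE : k.+1%:R = const_frac k.+1%:R :> {fraction {poly K}}.
  by rewrite /const_frac !rmorph_nat.
have -> : derive_frac (z * w * (z ^+ k * f1)) - const_frac c * (z ^+ k * f1) =
    z ^+ k * ((k.+1%:R * w - const_frac c) * f1 + z * derive_frac (w * f1)).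
  have -> : z * w * (z ^+ k * f1) = z ^+ k.+1 * (w * f1) by rewrite exprS; ring.
  by rewrite derive_fracM derive_fracX z'E /= [z ^+ k.+1]exprS; ring.
have r1 : regular (k.+1%:R * w - const_frac c) x.
  rewrite kE -rmorphN -polyCN; apply: regularD (regular_poly _ _).
  by apply: regularM wx; exact: regular_poly.
have r2 : regular (z * derive_frac (w * f1)) x.
  by apply: regularM zx _; exact: regular_derive.
split.
  by exists ((k.+1%:R * w - const_frac c) * f1 + z * derive_frac (w * f1));
    [apply: regularD r2; exact: regularM|].
move=> cE; case: (regular_factor r1) => [|h hx ->].
  rewrite kE -rmorphN -polyCN.
  rewrite (rat_evalD (regularM (regular_poly _ _) wx) (regular_poly _ _)).
  by rewrite (rat_evalM (regular_poly _ _) wx) !rat_eval_poly !hornerC cE subrr.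
exists (h * f1 + derive_frac (w * f1)).
  by apply: regularD; [exact: regularM|exact: regular_derive].
by rewrite -/z exprSr; ring.
Qed.

Lemma vanishes_div x k m p f : P != 0 ->
    regular p x -> rat_eval p x != 0 -> P = ('X - x%:P)%:F ^+ m * p ->
  vanishes x (m * k) f -> regular (f / P ^+ k) x.
Proof.
move=> P0 px px0 PE [f1 f1x ->].
have z0 : ('X - x%:P)%:F != 0 by rewrite tofrac_eq0 polyXsubC_eq0.
rewrite [in P ^+ k]PE exprMn -exprM invfM mulrACA (mulfV (expf_neq0 _ z0)) mul1r.
apply: regularM f1x _; rewrite -exprVn; apply: regularX; exact: regularV.
Qed.

End OrderOfVanishing.

(** * Cancelling a polynomial in P from vanishing moments *)

Lemma deriv_eq0_size (K : numFieldType) (p : {poly K}) : p^`() = 0 -> (size p <= 1)%N.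
Proof.
move=> p'0; apply/leq_sizeP => -[//|j] _; apply/eqP.
have /eqP := congr1 (fun r : {poly K} => r`_j) p'0.
by rewrite coef_deriv coef0 -mulr_natr mulf_eq0 pnatr_eq0 orbF.
Qed.

Section MomentTorsion.
Variables (K : numClosedFieldType) (P : {fraction {poly K}}) (za zb : K).
Hypotheses (P_infty : (size (rden P) < size (rnum P))%N).
Hypotheses (Pza : regular P za) (Pzb : regular P zb).
Implicit Types (f g : {fraction {poly K}}) (x c : K).

(** If the derivative were zero, coprimality would make [rnum P] divide its own derivative, hence be
    constant, against the pole at infinity. *)
Lemma derive_frac_neq0 : derive_frac P != 0.
Proof.
apply/negP => /eqP; rewrite [in derive_frac P](rnum_rdenE P).
rewrite (derive_frac_div _ (rden_neq0 P)) => /eqP.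
rewrite mulf_eq0 invr_eq0 !tofrac_eq0 (negbTE (expf_neq0 2 (rden_neq0 P))) orbF.
rewrite subr_eq0 => /eqP e.
have : rnum P %| (rnum P)^`() * rden P by rewrite e dvdp_mulr.
rewrite Gauss_dvdpl ?coprimep_rnum_rden // => d.
have n'0 : (rnum P)^`() = 0.
  apply/eqP; apply: contraTT d => n'0.
  apply/negP => /(dvdp_leq n'0); rewrite leqNgt lt_size_deriv //.
  by apply: contraTneq P_infty => ->; rewrite size_poly0.
have := leq_trans P_infty (deriv_eq0_size n'0).
by rewrite ltnS leqn0 size_poly_eq0 (negbTE (rden_neq0 P)).
Qed.

(** A zero [y] of [n] where [P] is finite and nonzero is cancelled by the factor [P - P(y)], whose
    polynomial does not vanish at 0. The other zeros of [n] are not among the points tested. *)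
Lemma clear_denominator (n : {poly K}) : n != 0 ->
  exists2 beta : {poly K}, beta.[0] != 0 &
    forall x, regular P x -> rat_eval P x != 0 -> regular (poly_at P beta / n%:F) x.
Proof.
move=> n0; have [r nE] := closed_field_poly_normal n.
have [beta b0 betaP] : exists2 beta : {poly K}, beta.[0] != 0 &
    forall x, regular P x -> rat_eval P x != 0 ->
      regular (poly_at P beta / (\prod_(z <- r) ('X - z%:P))%:F) x.
  elim: r {nE} => [|y r [beta b0 betaP]].
    exists 1 => [|x Px _]; first by rewrite hornerC oner_neq0.
    by rewrite big_nil poly_at1 tofrac1 divr1 -tofrac1; exact: regular_poly.
  have [/andP[Py ey]|yNP] := boolP (regular P y && (rat_eval P y != 0)).
    exists (('X - (rat_eval P y)%:P) * beta) => [|x Px ex].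
      by rewrite hornerM hornerXsubC sub0r mulf_neq0 // oppr_eq0.
    rewrite big_cons tofracM poly_atM invfM mulrACA.
    apply: regularM (betaP x Px ex).
    have [->|xy] := eqVneq x y; last first.
      apply: regularM; first exact: poly_at_regular.
      rewrite -[_^-1]mul1r -tofrac1; apply: regular_div.
      by rewrite hornerXsubC subr_eq0.
    have ey0 : rat_eval (poly_at P ('X - (rat_eval P y)%:P)) y = 0.
      by rewrite (rat_eval_poly_at _ Py) hornerXsubC subrr.
    have [h hy ->] := regular_factor (poly_at_regular _ Py) ey0.
    have z0 : ('X - y%:P)%:F != 0 by rewrite tofrac_eq0 polyXsubC_eq0.
    by rewrite mulrAC (mulfV z0) mul1r.
  (* Here [y] is a pole or a zero of [P], hence different from [x]. *)
  exists beta => [//|x Px ex]; rewrite big_cons tofracM invfM mulrCA.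
  apply: regularM (betaP x Px ex).
  rewrite -[_^-1]mul1r -tofrac1; apply: regular_div; rewrite hornerXsubC subr_eq0.
  by apply: contraNneq yNP => <-; rewrite Px.
exists beta => [//|x Px ex]; rewrite nE -mul_polyC tofracM invfM mulrCA.
apply: regularM (betaP x Px ex).
rewrite -[_^-1]mul1r -tofrac1; apply: regular_div.
by rewrite hornerC lead_coef_eq0.
Qed.

(** Away from the zeros of [P], the poles of [1 / P'] are removed by [clear_denominator]; at a zero
    of [P], the quotient [P / P'] itself vanishes. *)
Lemma exists_multiplier : exists (beta : {poly K}) G,
  [/\ beta.[0] != 0, regular_off_poles P G,
      rat_eval G za = 0, rat_eval G zb = 0 & G = poly_at P beta * P / derive_frac P].
Proof.
have P'0 := derive_frac_neq0.
have P0 : P != 0.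
  apply: contra_neq P'0 => ->; rewrite -tofrac0 derive_frac_poly.
  by rewrite derivC.
have n0 : rnum (derive_frac P) != 0.
  by apply: contra_neq P'0 => n0; rewrite (rnum_rdenE (derive_frac P)) n0 tofrac0 mul0r.
have [beta b0 betaP] := clear_denominator n0.
(* The factor that makes [G] vanish at an end point. Where [P] is zero, [G] vanishes already, and
   the factor ['X] would destroy [B.[0] != 0]. *)
pose e x : {poly K} := if rat_eval P x == 0 then 1 else 'X - (rat_eval P x)%:P.
have e0 x : (e x).[0] != 0.
  rewrite /e; case: (eqVneq (rat_eval P x) 0) => [_|ex]; first by rewrite hornerC oner_neq0.
  by rewrite hornerXsubC sub0r oppr_eq0.
pose B := e za * e zb * beta; pose G := poly_at P B * P / derive_frac P.
have B0 : B.[0] != 0 by rewrite !hornerM !mulf_neq0.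
have GE : G = poly_at P (e za * e zb) *
    (poly_at P beta / (rnum (derive_frac P))%:F * ((rden (derive_frac P))%:F * P)).
  rewrite /G /B poly_atM [in _ / derive_frac P](rnum_rdenE (derive_frac P)) invf_div.
  ring.
have G1x x : regular P x -> rat_eval P x != 0 -> regular
    (poly_at P beta / (rnum (derive_frac P))%:F * ((rden (derive_frac P))%:F * P)) x.
  move=> Px ex; apply: regularM; first exact: betaP.
  by apply: regularM Px; exact: regular_poly.
have Gzero x : regular P x -> rat_eval P x = 0 -> regular G x /\ rat_eval G x = 0.
  move=> Px ex; have [m [p [px px0 PE]]] := zero_factor P0 Px ex.
  have [w [wx _ GwE]] := log_derivative_local B Px ex px px0 PE.
  have zx : regular ('X - x%:P)%:F x by exact: regular_poly.
  rewrite /G GwE; split; first exact: regularM.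
  by rewrite (rat_evalM zx wx) rat_eval_poly hornerXsubC subrr mul0r.
have Geval x : regular P x -> (e x %| e za * e zb) -> rat_eval G x = 0.
  move=> Px /dvdpP[u uE].
  have [ex|ex] := eqVneq (rat_eval P x) 0; first by case: (Gzero x Px ex).
  rewrite GE (rat_evalM (poly_at_regular _ Px) (G1x x Px ex)).
  rewrite (rat_eval_poly_at _ Px) uE hornerM /e (negbTE ex) hornerXsubC subrr.
  by rewrite mulr0 mul0r.
exists B, G; split; [exact: B0| | | |exact: erefl].
- move=> x Px; have [ex|ex] := eqVneq (rat_eval P x) 0.
    by case: (Gzero x Px ex).
  by rewrite GE; apply: regularM (G1x x Px ex); exact: poly_at_regular.
- by apply: Geval => //; exact: dvdp_mulr.
- by apply: Geval => //; exact: dvdp_mull.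
Qed.

(** All poles of [f] are roots of [rden P], so [rden f] divides a power of [rden P]; the span is
    stable under division by such powers. *)
Lemma regular_off_poles_polyspan f : regular_off_poles P f -> polyspan P (size (rnum P)).-1 f.
Proof.
move=> hf; have [r rE] := closed_field_poly_normal (rden f).
have rP : all (root (rden P)) r.
  apply/allP => y yr; apply: contraT => /hf; rewrite /regular rE.
  by rewrite rootZ ?lead_coef_eq0 ?rden_neq0 // root_prod_XsubC yr.
have /dvdpP[u uE] : rden f %| rden P ^+ size r.
  rewrite rE dvdpZl ?lead_coef_eq0 ?rden_neq0 //.
  elim: r rP {rE} => [_|y r IHr /= /andP[Py /IHr rP]]; first by rewrite big_nil dvd1p.
  by rewrite big_cons exprS dvdp_mul // dvdp_XsubCl.
have fE : f = (rnum f * u)%:F * 1 / (rden P)%:F ^+ size r.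
  rewrite -tofracXn uE !tofracM mulr1 invfM [_^-1 * _]mulrC mulrACA.
  have u0 : u%:F != 0.
    rewrite tofrac_eq0; apply: contraTneq (expf_neq0 (size r) (rden_neq0 P)) => u0.
    by rewrite uE u0 mul0r eqxx.
  by rewrite (mulfV u0) mulr1 -rnum_rdenE.
rewrite fE; apply: (polyspan_div_rden P_infty); apply: (polyspan_mul_poly P_infty).
rewrite -tofrac1; apply: polyspan_poly; rewrite size_poly1.
have n1 : (1 < size (rnum P))%N.
  by apply: leq_ltn_trans P_infty; rewrite size_poly_gt0 rden_neq0.
by rewrite -ltnS prednK //; exact: ltnW.
Qed.

(** [L] abstracts integration along the curve: linearity on O and the fundamental theorem of
    calculus. *)
Variable L : {fraction {poly K}} -> K.
Hypothesis LD : forall f g, regular_off_poles P f -> regular_off_poles P g ->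
  L (f + g) = L f + L g.
Hypothesis LZ : forall c f, regular_off_poles P f ->
  L (const_frac c * f) = c * L f.
Hypothesis L_derive : forall f, regular_off_poles P f ->
  L (derive_frac f) = rat_eval f zb - rat_eval f za.

Let reg_const c : regular_off_poles P (const_frac c).
Proof. exact: regular_off_poles_poly. Qed.

Let delta_moments f c := regular_off_poles P f /\
  forall i, L (P ^+ i * f) = if i == 0%N then c else 0.

(** All moments after the [i]-th vanish, so only the constant term of [a] contributes. *)
Let moments_poly_at (a : {poly K}) f c i :
  regular_off_poles P f -> (forall j, L (P ^+ (i + j) * f) = if j == 0%N then c else 0) ->
  L (P ^+ i * (poly_at P a * f)) = a.[0] * c.
Proof.
move=> hf; elim/poly_ind: a i c => [|a d IHa] i c Lf.
  have -> : P ^+ i * (poly_at P 0 * f) = const_frac 0 * f.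
    by rewrite poly_at0 /const_frac tofrac0 !mul0r mulr0.
  by rewrite LZ // horner0 !mul0r.
have -> : P ^+ i * (poly_at P (a * 'X + d%:P) * f) =
    P ^+ i.+1 * (poly_at P a * f) + const_frac d * (P ^+ i * f).
  by rewrite poly_atD poly_atM poly_atX poly_atC exprS; ring.
have hX j : regular_off_poles P (P ^+ j) by exact: regular_off_polesX.
rewrite LD; last 2 first.
- by do 2 apply: regular_off_polesM => //; exact: regular_off_poles_at.
- by do 2 apply: regular_off_polesM => //.
rewrite (IHa _ 0) => [|j]; last by rewrite addSnnS Lf; case: ifP.
rewrite LZ; last exact: regular_off_polesM.
by rewrite mulr0 add0r -[i in P ^+ i]addn0 Lf hornerMXaddC mulr0 add0r.
Qed.

(** Torsion is meant modulo the functions of O with all moments zero: [P * q] is such a function,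
    and so must be [q]. *)
Lemma no_moment_torsion q : regular_off_poles P q ->
  (forall i, L (P ^+ i.+1 * q) = 0) -> L q = 0.
Proof.
move=> hq Lq; apply/eqP; apply: contraT => Lq0.
have hX j : regular_off_poles P (P ^+ j) by exact: regular_off_polesX.
have P'0 := derive_frac_neq0.
have P0 : P != 0.
  apply: contra_neq P'0 => ->; rewrite -tofrac0 derive_frac_poly.
  by rewrite derivC.
have [beta [G [b0 hG Gza Gzb GE]]] := exists_multiplier.
(* Integration by parts: [G] vanishes at the end points and [P' * G = beta(P) * P], so the [i]-th
   moment of [(G * f)'] is [- i] times that of [beta(P) * f]. It is zero for [i = 0] because of the
   factor, and for [i > 0] because the higher moments of [f] vanish. *)
have step f c lambda : delta_moments f c ->
    delta_moments (derive_frac (G * f) - const_frac lambda * f) (- lambda * c).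
  move=> [hf Lf].
  have hGf : regular_off_poles P (G * f) by exact: regular_off_polesM.
  have hE : regular_off_poles P (derive_frac (G * f)).
    exact: regular_off_poles_derive.
  have fE : derive_frac (G * f) - const_frac lambda * f =
      derive_frac (G * f) + const_frac (- lambda) * f.
    by rewrite /const_frac polyCN tofracN mulNr.
  rewrite fE; split => [|i].
    by apply: regular_off_polesD hE _; exact: regular_off_polesM.
  have hPf : regular_off_poles P (P ^+ i * f) by exact: regular_off_polesM.
  have hbf : regular_off_poles P (P ^+ i * (poly_at P beta * f)).
    apply: regular_off_polesM => //; apply: regular_off_polesM => //.
    exact: regular_off_poles_at.
  have hPE : regular_off_poles P (P ^+ i * (G * f)) by exact: regular_off_polesM.
  have hPE' : regular_off_poles P (derive_frac (P ^+ i * (G * f))).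
    exact: regular_off_poles_derive.
  have -> : P ^+ i * (derive_frac (G * f) + const_frac (- lambda) * f) =
      derive_frac (P ^+ i * (G * f)) +
      (const_frac (- i%:R) * (P ^+ i * (poly_at P beta * f)) +
       const_frac (- lambda) * (P ^+ i * f)).
    have G' : derive_frac P * G = poly_at P beta * P.
      by rewrite GE mulrCA (mulfV P'0) mulr1.
    have -> : const_frac (- i%:R : K) = - i%:R.
      by rewrite /const_frac polyCN tofracN !rmorph_nat.
    rewrite (derive_fracM (P ^+ i)) derive_fracX.
    case: i {hPf hbf hPE hPE'} => [|i] /=; first by ring.
    have -> : i.+1%:R * P ^+ i * derive_frac P * (G * f) =
        i.+1%:R * P ^+ i * f * (derive_frac P * G) by ring.
    by rewrite G' exprSr; ring.
  rewrite (LD hPE'); last by apply: regular_off_polesD; exact: regular_off_polesM.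
  rewrite (L_derive hPE) !rat_evalM; try by [exact: hX|exact: hG|exact: hf|exact: hGf].
  rewrite Gza Gzb !mul0r !mulr0 subrr add0r.
  rewrite LD; [|exact: regular_off_polesM|exact: regular_off_polesM].
  rewrite (LZ _ hbf) (LZ _ hPf) Lf.
  have [->|i0] := eqVneq i 0%N; first by rewrite oppr0 mul0r add0r.
  rewrite mulr0 addr0 (moments_poly_at _ hf (c := 0)) ?mulr0 // => j.
  by rewrite Lf addn_eq0 (negbTE i0) /=; case: ifP.
pose hW f := regular_off_poles P f /\ forall i, L (P ^+ i * f) = 0.
(* The exponent [N] is fixed before any function is constructed; orders of vanishing are then raised
   far enough for this [N]. *)
have [N HN] : exists N, forall f, polyspan P (size (rnum P)).-1 f ->
    (exists k, hW (P ^+ k * f)) -> hW (P ^+ N * f).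
  apply: stable_exponent => [f g [hf Lf] [hg Lg]|a f [hf Lf]].
    split=> [|i]; first exact: regular_off_polesD.
    by rewrite mulrDr LD ?Lf ?Lg ?addr0 //; exact: regular_off_polesM.
  split=> [|i]; first by apply: regular_off_polesM hf; exact: regular_off_poles_at.
  by rewrite (moments_poly_at _ hf (c := 0)) ?mulr0 // => j; rewrite Lf; case: ifP.
(* One application of the operator gains one order at [x] and loses none at the other zeros of
   [P]. *)
have raise x m p : regular P x -> rat_eval P x = 0 -> regular p x ->
    rat_eval p x != 0 -> P = ('X - x%:P)%:F ^+ m.+1 * p ->
    forall k f c, delta_moments f c -> c != 0 ->
    exists f' c', [/\ delta_moments f' c', c' != 0, vanishes x k f' &
      forall y j, regular P y -> rat_eval P y = 0 -> vanishes y j f -> vanishes y j f'].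
  move=> Px ex px px0 PE; elim=> [|k IHk] f c df c0.
    exists f, c; split; [exact: df|exact: c0| |by []].
    by exists f; [case: df => hf _; exact: hf|rewrite mul1r].
  have [f1 [c1 [df1 c10 vf1 f1P]]] := IHk f c df c0.
  have [w [wx ew GwE]] := log_derivative_local beta Px ex px px0 PE.
  rewrite -GE in GwE.
  (* The value that annihilates the leading coefficient, since [w] takes the value [beta.[0] /
     m.+1%:R] at [x]. It is nonzero, so the zeroth moment stays nonzero. *)
  set lambda := k.+1%:R * (beta.[0] / m.+1%:R).
  have l0 : lambda != 0 by rewrite !mulf_neq0 ?invr_eq0 ?pnatr_eq0.
  exists (derive_frac (G * f1) - const_frac lambda * f1), (- lambda * c1); split.
  - exact: step.
  - by rewrite mulf_neq0 // oppr_eq0.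
  - by have [_] := vanishes_step lambda wx GwE vf1; apply; rewrite ew.
  - move=> y j Py ey /(f1P y j Py ey) vy.
    have [m' [p' [p'y p'y0 PE']]] := zero_factor P0 Py ey.
    have [w' [w'y _ Gw'E]] := log_derivative_local beta Py ey p'y p'y0 PE'.
    rewrite -GE in Gw'E.
    by have [] := vanishes_step lambda w'y Gw'E vy.
have [r rE] := closed_field_poly_normal (rnum P).
have zr x : regular P x -> rat_eval P x = 0 -> x \in r.
  move=> Px /eqP; rewrite mulf_eq0 invr_eq0 -!/(root _ _) (negbTE Px) orbF rE.
  rewrite rootZ ?root_prod_XsubC // lead_coef_eq0.
  by apply: contraTneq P_infty => ->; rewrite size_poly0.
(* The zeros are treated one after another, starting from [q]. Order [m * N] at each zero of
   multiplicity [m] is what division by [P ^+ N] requires. *)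
have all_zeros (s : seq K) : exists f c, [/\ delta_moments f c, c != 0 & forall x, x \in s ->
    regular P x -> rat_eval P x = 0 -> exists m p, [/\ regular p x, rat_eval p x != 0,
      P = ('X - x%:P)%:F ^+ m * p & vanishes x (m * N) f]].
  elim: s => [|y s [f [c [df c0 sf]]]].
    exists q, (L q); split; [split; first exact: hq|exact: Lq0|by []].
    by case=> [|i]; [rewrite mul1r|exact: Lq].
  have [/andP[Py /eqP ey]|yNP] := boolP (regular P y && (rat_eval P y == 0)); last first.
    exists f, c; split; [exact: df|exact: c0|move=> x; rewrite inE].
    move=> /orP[/eqP ->|/sf//] Py ey.
    by rewrite Py ey eqxx in yNP.
  have [m [p [py py0 PE]]] := zero_factor P0 Py ey.
  have [f' [c' [df' c'0 vf' f'P]]] := raise y m p Py ey py py0 PE (m.+1 * N)%N f c df c0.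
  exists f', c'; split; [exact: df'|exact: c'0|move=> x; rewrite inE].
  move=> /orP[/eqP -> _ _|xs Px ex].
    by exists m.+1, p.
  have [m' [p' [? ? ? vx]]] := sf x xs Px ex.
  by exists m', p'; split; [| | |exact: f'P].
have [f [c [[hf Lf] c0 fr]]] := all_zeros r.
pose h := f / P ^+ N.
have hh : regular_off_poles P h.
  move=> x Px; have [ex|ex] := eqVneq (rat_eval P x) 0.
    have [m [p [px px0 PE vf]]] := fr x (zr x Px ex) Px ex.
    exact: (vanishes_div P0 px px0 PE vf).
  apply: regularM; first exact: hf.
  by rewrite -exprVn; apply: regularX; exact: regularV.
have fE : f = P ^+ N * h by rewrite mulrCA (mulfV (expf_neq0 N P0)) mulr1.
(* [P ^+ N.+1 * h = P * f] has only zero moments, so [h] is torsion and [P ^+ N * h = f] would have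
   zero moments too, against [c != 0]. *)
have [] : hW (P ^+ N * h).
  apply: HN; first exact: regular_off_poles_polyspan.
  exists N.+1; split => [|i]; first exact: regular_off_polesM.
  by rewrite exprS -mulrA mulrA -exprSr -fE Lf.
by move=> _ /(_ 0%N); rewrite -fE Lf eqxx => cE; rewrite cE eqxx in c0.
Qed.

End MomentTorsion.

(** The cross relation preserves the difference of the degrees of numerator and denominator. *)
Lemma infinity_div (K : fieldType) (n d : {poly K}) : d != 0 ->
  (size (rden (n%:F / d%:F)) < size (rnum (n%:F / d%:F)))%N = (size d < size n)%N.
Proof.
move=> d0; have := frac_cross d0 (erefl (n%:F / d%:F)); set f := _ / _ => e.
have r0 := rden_neq0 f.
have [n0|n0] := eqVneq n 0.
  have -> : rnum f = 0.
    move: e; rewrite n0 mul0r => /eqP; rewrite mulf_eq0 (negbTE d0) orbF.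
    by move=> /eqP.
  by rewrite n0 size_poly0 !ltn0.
have N0 : rnum f != 0.
  by apply: contra_eq_neq e => ->; rewrite mul0r eq_sym mulf_neq0.
have := congr1 (fun p : {poly K} => size p) e; rewrite !size_mul //.
rewrite -!size_poly_gt0 in n0 N0 r0 d0; move: n0 N0 r0 d0.
move: (size n) (size d) (size (rnum f)) (size (rden f)) => sn sd sN sD.
lia.
Qed.

Section MomentDivision.
Variables (K : numClosedFieldType) (P : {fraction {poly K}}) (za zb : K).
Hypotheses (P_infty : (size (rden P) < size (rnum P))%N).
Hypotheses (Pza : regular P za) (Pzb : regular P zb).
Variable L : {fraction {poly K}} -> K.
Hypothesis LD : forall f g, regular_off_poles P f -> regular_off_poles P g ->
  L (f + g) = L f + L g.
Hypothesis LZ : forall c f, regular_off_poles P f ->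
  L (const_frac c * f) = c * L f.
Hypothesis L_derive : forall f, regular_off_poles P f ->
  L (derive_frac f) = rat_eval f zb - rat_eval f za.

(** [T = P - t] has the same poles as [P], also at infinity, and hence the same ring O, so
    [no_moment_torsion] applies to [T]. *)
Lemma moments_shift t q : regular_off_poles P q ->
  (forall i, L (P ^+ i * ((P - const_frac t) * q)) = 0) ->
  forall i, L (P ^+ i * q) = 0.
Proof.
move=> hq Lq; set T := P - const_frac t.
have TE : T = ((rnum P - t *: rden P)%:F / (rden P)%:F).
  have d0 : (rden P)%:F != 0 by rewrite tofrac_eq0 rden_neq0.
  rewrite tofracB mulrBl -rnum_rdenE -mul_polyC tofracM.
  by rewrite -[_%:P%:F * _ / _]mulrA (mulfV d0) mulr1.
have T_infty : (size (rden T) < size (rnum T))%N.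
  rewrite TE (infinity_div _ (rden_neq0 P)) size_polyDl ?size_polyN //.
  exact: leq_ltn_trans (size_scale_leq _ _) P_infty.
have PT x : regular P x -> regular T x.
  by move=> Px; rewrite /T /const_frac -tofracN; apply: regularD (regular_poly _ _).
have TP x : regular T x -> regular P x.
  by move=> Tx; rewrite -[P](subrK (const_frac t)); apply: regularD (regular_poly _ _).
have offTP f : regular_off_poles T f -> regular_off_poles P f.
  by move=> hf x /PT; exact: hf.
have offPT f : regular_off_poles P f -> regular_off_poles T f.
  by move=> hf x /TP; exact: hf.
have hX j : regular_off_poles P (P ^+ j) by exact: regular_off_polesX.
have hT : regular_off_poles P T by exact: PT.
(* The hypothesis concerns powers of [P]; expanding one factor [T = P - t] at a time turns it into
   powers of [T]. *)
have LTq i j : L (P ^+ j * (T ^+ i.+1 * q)) = 0.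
  elim: i j => [|i IHi] j; first by rewrite expr1; exact: Lq.
  have -> : P ^+ j * (T ^+ i.+2 * q) =
      P ^+ j.+1 * (T ^+ i.+1 * q) + const_frac (- t) * (P ^+ j * (T ^+ i.+1 * q)).
    rewrite /const_frac polyCN tofracN -/(const_frac t) [T ^+ i.+2]exprS.
    by rewrite {1}/T [P ^+ j.+1]exprSr; ring.
  have hTq : regular_off_poles P (T ^+ i.+1 * q).
    by apply: regular_off_polesM hq => x Px; apply: regularX; exact: PT.
  rewrite LD; first last.
  - by apply: regular_off_polesM; [exact: regular_off_poles_poly|exact: regular_off_polesM].
  - exact: regular_off_polesM.
  rewrite LZ; first by rewrite !IHi mulr0 addr0.
  exact: regular_off_polesM.
have Lq0 : L q = 0.
  apply: (no_moment_torsion T_infty (PT _ Pza) (PT _ Pzb)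
    (fun f g hf hg => LD (offTP f hf) (offTP g hg))
    (fun c f hf => LZ c (offTP f hf)) (fun f hf => L_derive (offTP f hf)) (offPT q hq)).
  by move=> i; have := LTq i 0%N; rewrite mul1r.
elim=> [|i IHi]; first by rewrite mul1r.
have -> : P ^+ i.+1 * q = P ^+ i * (T * q) + const_frac t * (P ^+ i * q).
  by rewrite /T exprSr; ring.
rewrite LD; first last.
- by apply: regular_off_polesM; [exact: regular_off_poles_poly|exact: regular_off_polesM].
- by apply: regular_off_polesM => //; exact: regular_off_polesM.
rewrite LZ; first by rewrite IHi mulr0 addr0; exact: Lq.
exact: regular_off_polesM.
Qed.

(** [B] splits into linear factors, which [moments_shift] removes one by one. *)
Lemma moments_divide (B : {poly K}) q : B != 0 -> regular_off_poles P q ->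
  (forall i, L (P ^+ i * (poly_at P B * q)) = 0) ->
  forall i, L (P ^+ i * q) = 0.
Proof.
move=> B0; have [r rE] := closed_field_poly_normal B.
have l0 : lead_coef B != 0 by rewrite lead_coef_eq0.
have hX j : regular_off_poles P (P ^+ j) by exact: regular_off_polesX.
move=> hq LB.
have {}LB i : L (P ^+ i * (poly_at P (\prod_(z <- r) ('X - z%:P)) * q)) = 0.
  have := LB i; rewrite rE -mul_polyC poly_atM poly_atC -mulrA mulrCA LZ.
    by move=> /eqP; rewrite mulf_eq0 (negbTE l0) => /eqP.
  apply: regular_off_polesM => //; apply: regular_off_polesM => //.
  exact: regular_off_poles_at.
elim: r {rE} LB => [|t r IHr].
  by rewrite big_nil poly_at1 mul1r.
rewrite big_cons poly_atM => LB; apply: IHr; apply: (moments_shift (t := t)).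
  by apply: regular_off_polesM hq; exact: regular_off_poles_at.
move=> i; rewrite -[RHS](LB i); congr (L (_ * _)).
by rewrite mulrA poly_atD poly_atN poly_atX poly_atC.
Qed.

End MomentDivision.

(** * Complex-valued functions of a real variable *)

Section ComplexLimits.
Variable R : realType.
Local Notation Re := (@complex.Re R).
Local Notation Im := (@complex.Im R).
Implicit Types (x y z l : R[i]) (f : {fraction {poly R[i]}}) (p : {poly R[i]}).

Lemma cReD x y : Re (x + y) = Re x + Re y. Proof. by case: x y => [? ?] []. Qed.
Lemma cImD x y : Im (x + y) = Im x + Im y. Proof. by case: x y => [? ?] []. Qed.
Lemma cReN x : Re (- x) = - Re x. Proof. by case: x. Qed.
Lemma cImN x : Im (- x) = - Im x. Proof. by case: x. Qed.
Lemma cReM x y : Re (x * y) = Re x * Re y - Im x * Im y.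
Proof. by case: x y => [? ?] []. Qed.
Lemma cImM x y : Im (x * y) = Re x * Im y + Im x * Re y.
Proof. by case: x y => [? ?] []. Qed.
Lemma cReV x : Re x^-1 = Re x / (Re x ^+ 2 + Im x ^+ 2).
Proof. by case: x. Qed.
Lemma cImV x : Im x^-1 = - (Im x / (Re x ^+ 2 + Im x ^+ 2)).
Proof. by case: x. Qed.
Lemma complex_eqP x y : Re x = Re y -> Im x = Im y -> x = y.
Proof. by case: x y => [a b] [c d] /= -> ->. Qed.
Lemma sqr_modulus_neq0 x : x != 0 -> Re x ^+ 2 + Im x ^+ 2 != 0.
Proof.
case: x => a b /=; apply: contraNneq => /eqP; rewrite paddr_eq0 ?sqr_ge0 //.
by rewrite !sqrf_eq0 => /andP[/eqP-> /eqP->].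
Qed.

(** Convergence by components, the form in which velocities and curve integrals are given. *)
Definition ccvg (T : Type) (F : set_system T) (h : T -> R[i]) l :=
  (fun t => Re (h t)) @ F --> Re l /\ (fun t => Im (h t)) @ F --> Im l.

Section Filter.
Variables (T : Type) (F : set_system T).
Context {FF : Filter F}.
Implicit Types h k : T -> R[i].

Lemma ccvg_cst l : ccvg F (fun=> l) l.
Proof. by split; exact: cvg_cst. Qed.

Lemma ccvgD h k l m : ccvg F h l -> ccvg F k m -> ccvg F (fun t => h t + k t) (l + m).
Proof.
move=> [hr hi] [kr ki]; rewrite /ccvg cReD cImD.
under eq_fun do rewrite cReD; under [X in _ /\ X @ _ --> _]eq_fun do rewrite cImD.
by split; exact: cvgD.
Qed.

Lemma ccvgM h k l m : ccvg F h l -> ccvg F k m -> ccvg F (fun t => h t * k t) (l * m).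
Proof.
move=> [hr hi] [kr ki]; rewrite /ccvg cReM cImM.
under eq_fun do rewrite cReM; under [X in _ /\ X @ _ --> _]eq_fun do rewrite cImM.
by split; [apply: cvgB|apply: cvgD]; exact: cvgM.
Qed.

Lemma ccvgV h l : l != 0 -> ccvg F h l -> ccvg F (fun t => (h t)^-1) l^-1.
Proof.
move=> /sqr_modulus_neq0 l0 [hr hi]; rewrite /ccvg cReV cImV.
under eq_fun do rewrite cReV; under [X in _ /\ X @ _ --> _]eq_fun do rewrite cImV.
have s : (fun t => (Re (h t) ^+ 2 + Im (h t) ^+ 2)^-1) @ F --> (Re l ^+ 2 + Im l ^+ 2)^-1.
  by apply: cvgV => //; apply: cvgD; apply: cvgM.
by split; [|apply: cvgN]; apply: cvgM.
Qed.

Lemma ccvg_poly p h l : ccvg F h l -> ccvg F (fun t => p.[h t]) p.[l].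
Proof.
move=> hl; elim/poly_ind: p => [|p c IHp].
  by rewrite horner0; under eq_fun do rewrite horner0; exact: ccvg_cst.
rewrite hornerMXaddC; under eq_fun do rewrite hornerMXaddC.
by apply: ccvgD (ccvg_cst c); exact: ccvgM.
Qed.

Lemma ccvg_rat f h l : regular f l -> ccvg F h l ->
  ccvg F (fun t => rat_eval f (h t)) (rat_eval f l).
Proof.
by move=> fl hl; apply: ccvgM; [|apply: ccvgV => //]; exact: ccvg_poly.
Qed.
End Filter.

Definition cderive (h : R -> R[i]) (s : R) (d : R[i]) :=
  is_derive s 1 (fun t => Re (h t)) (Re d) /\ is_derive s 1 (fun t => Im (h t)) (Im d).

Section Derivative.
Implicit Types (h k : R -> R[i]) (s : R) (d e : R[i]).

Lemma cderive_cst l s : cderive (fun=> l) s 0.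
Proof. by split; exact: is_derive_cst. Qed.

Lemma cderiveD h k s d e : cderive h s d -> cderive k s e ->
  cderive (fun t => h t + k t) s (d + e).
Proof.
move=> [hr hi] [kr ki]; rewrite /cderive cReD cImD.
under eq_fun do rewrite cReD; under [X in _ /\ is_derive _ _ X _]eq_fun do rewrite cImD.
by split; exact: is_deriveD.
Qed.

Lemma cderiveM h k s d e : cderive h s d -> cderive k s e ->
  cderive (fun t => h t * k t) s (d * k s + h s * e).
Proof.
move=> [hr hi] [kr ki]; rewrite /cderive cReD cImD !cReM !cImM.
under eq_fun do rewrite cReM; under [X in _ /\ is_derive _ _ X _]eq_fun do rewrite cImM.
split.
  apply: is_derive_eq (is_deriveB (is_deriveM hr kr) (is_deriveM hi ki)) _.
  by rewrite /GRing.scale /=; ring.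
apply: is_derive_eq (is_deriveD (is_deriveM hr ki) (is_deriveM hi kr)) _.
by rewrite /GRing.scale /=; ring.
Qed.

Lemma cderiveV h s d : h s != 0 -> cderive h s d ->
  cderive (fun t => (h t)^-1) s (- d / (h s) ^+ 2).
Proof.
move=> hs0 [hr hi]; have n0 := sqr_modulus_neq0 hs0.
rewrite /cderive.
under eq_fun do rewrite cReV; under [X in _ /\ is_derive _ _ X _]eq_fun do rewrite cImV.
have nd := is_deriveD (is_deriveM hr hr) (is_deriveM hi hi).
have nV := @is_deriveV R (fun t => Re (h t) ^+ 2 + Im (h t) ^+ 2) _ _ _ n0 nd.
have e : (h s) ^+ 2 = (Re (h s) ^+ 2 - Im (h s) ^+ 2) +i* (2 * Re (h s) * Im (h s)).
  by apply: complex_eqP; rewrite expr2 (cReM, cImM) /=; ring.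
(* The squared modulus of [h s ^+ 2] is the square of that of [h s]. *)
have n1 : (Re (h s) ^+ 2 - Im (h s) ^+ 2) ^+ 2 + (2 * Re (h s) * Im (h s)) ^+ 2 != 0.
  rewrite (_ : _ + _ = (Re (h s) ^+ 2 + Im (h s) ^+ 2) ^+ 2) ?expf_neq0 //; ring.
split.
  apply: is_derive_eq (is_deriveM hr nV) _.
  rewrite /GRing.scale /= cReM cReV cImV e /= cReN cImN.
  move: n0 n1; move: (Re (h s)) (Im (h s)) (Re d) (Im d) => u v u' v' n0 n1.
  by field; rewrite n0 n1.
have := is_deriveN (is_deriveM hi nV); move=> /(is_derive_eq); apply.
rewrite /GRing.scale /= cImM cReV cImV e /= cReN cImN.
move: n0 n1; move: (Re (h s)) (Im (h s)) (Re d) (Im d) => u v u' v' n0 n1.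
by field; rewrite n0 n1.
Qed.

Lemma cderive_poly p h s d : cderive h s d ->
  cderive (fun t => p.[h t]) s (p^`().[h s] * d).
Proof.
move=> hd; elim/poly_ind: p => [|p c IHp].
  under eq_fun do rewrite horner0.
  by rewrite derivC horner0 mul0r; exact: cderive_cst.
under eq_fun do rewrite hornerMXaddC.
have := cderiveD (cderiveM IHp hd) (cderive_cst c s).
rewrite derivD derivM derivX derivC addr0 mulr1 addr0 hornerD hornerM hornerX.
by rewrite mulrDl [p^`().[_] * d * _]mulrAC.
Qed.

Lemma cderive_rat f h s d : regular f (h s) -> cderive h s d ->
  cderive (fun t => rat_eval f (h t)) s (rat_eval (derive_frac f) (h s) * d).
Proof.
move=> fl hd.
have := cderiveM (cderive_poly (rnum f) hd) (cderiveV fl (cderive_poly (rden f) hd)).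
congr cderive.
have fl2 : (rden f ^+ 2).[h s] != 0 by rewrite horner_exp expf_neq0.
rewrite /derive_frac (rat_eval_div _ fl2) horner_exp hornerD hornerN !hornerM.
move: fl; rewrite /regular /root; move: (_.[_]) (_.[_]) (_.[_]) (_.[_]) => a b c e e0.
by field.
Qed.

End Derivative.
End ComplexLimits.

(** * Integration along a piecewise smooth curve *)

Section CurveIntegrals.
Variable R : realType.
Local Notation Re := (@complex.Re R).
Local Notation Im := (@complex.Im R).
Local Notation mu := (@lebesgue_measure R).
Implicit Types (a b c d e s : R) (k w : R -> R) (g v h : R -> R[i]).
Implicit Types f : {fraction {poly R[i]}}.

Definition integrable_on c d k := mu.-integrable `[c, d] (EFin \o k).

(** The common end point is assigned to the left piece; the right piece becomes half-open, which
    does not change its integral. *)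
Lemma integrable_on_join c d e k : c <= d -> d <= e ->
  integrable_on c d k -> integrable_on d e k ->
  integrable_on c e k /\ \int[mu]_(s in `[c, e]) k s =
    \int[mu]_(s in `[c, d]) k s + \int[mu]_(s in `[d, e]) k s.
Proof.
rewrite /integrable_on => cd de kcd kde.
have de' : `]d, e] `<=` `[d, e] by apply: subset_itvr; rewrite bnd_simp.
have kde' : mu.-integrable `]d, e] (EFin \o k) by exact: integrableS kde.
have ceE : `[c, e]%classic = `[c, d] `|` `]d, e].
  by apply: itv_bndbnd_setU; rewrite bnd_simp.
have dis : [disjoint `[c, d] & `]d, e]]%classic.
  apply/disj_setPS => x /= []; rewrite !in_itv /= => /andP[_ xd] /andP[dx _].
  by move: (lt_le_trans dx xd); rewrite ltxx.
have int : mu.-integrable (`[c, d] `|` `]d, e]) (EFin \o k).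
  have mk : measurable_fun (`[c, d] `|` `]d, e]) k.
    apply/measurable_funU => //; split; apply/measurable_EFinP.
      exact: measurable_int kcd.
    exact: measurable_int kde'.
  apply/integrableP; split; first exact/measurable_EFinP.
  rewrite ge0_integral_setU //=; last first.
    by do 2 apply: measurableT_comp => //.
  have [_ h1] := integrableP _ _ _ kcd.
  have [_ h2] := integrableP _ _ _ kde'.
  exact: lte_add_pinfty.
rewrite /integrable_on ceE; split => //.
rewrite Rintegral_setU //; congr (_ + _).
by rewrite Rintegral_itv_obnd_cbnd.
Qed.

(** End points are null sets. This allows the velocity, uncontrolled at the ends of an arc, to be
    replaced by its continuous extension. *)
Lemma integrable_on_interior c d k w : c < d ->
  {within `[c, d], continuous w} -> {in `]c, d[, k =1 w} ->
  integrable_on c d k /\ \int[mu]_(s in `[c, d]) k s = \int[mu]_(s in `[c, d]) w s.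
Proof.
move=> cd cw kw.
have iw : mu.-integrable `[c, d] (EFin \o w).
  by apply: continuous_compact_integrable => //; exact: segment_compact.
have iwo : mu.-integrable `]c, d[ (EFin \o w).
  by apply: integrableS iw => //; exact: subset_itv_oo_cc.
have iko : mu.-integrable `]c, d[ (EFin \o k).
  apply: eq_integrable iwo => // s; rewrite inE /= => scd.
  by rewrite kw.
have ik : mu.-integrable `[c, d] (EFin \o k).
  case/integrableP: iko => mk ik; apply/integrableP.
  have mk' : measurable_fun `[c, d] k.
    by apply: (@measurable_fun_itv_cc _ _ _ false true); exact/measurable_EFinP.
  split; first exact/measurable_EFinP.
  rewrite -integral_itv_obnd_cbnd; last first.
    apply: measurableT_comp => //; apply/measurable_EFinP.
    by apply: measurable_funS mk' => //; apply: subset_itvr; rewrite bnd_simp.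
  rewrite -integral_itv_bndo_bndc; last exact: measurableT_comp.
  exact: ik.
have oo (u : R -> R) : mu.-integrable `[c, d] (EFin \o u) ->
    \int[mu]_(s in `[c, d]) u s = \int[mu]_(s in `]c, d[) u s.
  move=> ih; rewrite -Rintegral_itv_obnd_cbnd; last first.
    by apply: integrableS ih => //; apply: subset_itvr; rewrite bnd_simp.
  rewrite -Rintegral_itv_bndo_bndc //.
  by apply: integrableS ih => //; exact: subset_itv_oo_cc.
split => //; rewrite !oo //; apply: eq_Rintegral => s; rewrite inE /= => scd.
exact: kw.
Qed.

Lemma Re_continuous : continuous (Re : R[i] -> R).
Proof.
move=> z; apply/(@cvgrPdist_lt _ _ _ _ (nbhs_filter z)) => e e0.
apply/nbhs_ballP; exists e%:C => /=; first by rewrite ltcR.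
move=> y; rewrite -ball_normE /= => zy; rewrite -ltcR.
by apply: le_lt_trans zy; rewrite -raddfB; exact: normc_ge_Re.
Qed.

Lemma Im_continuous : continuous (Im : R[i] -> R).
Proof.
move=> z; apply/(@cvgrPdist_lt _ _ _ _ (nbhs_filter z)) => e e0.
apply/nbhs_ballP; exists e%:C => /=; first by rewrite ltcR.
move=> y; rewrite -ball_normE /= => zy; rewrite -ltcR.
apply: le_lt_trans zy; rewrite -raddfB.
by case: (z - y) => a b; simpc; rewrite /= -sqrtr_sqr ler_wsqrtr // lerDr sqr_ge0.
Qed.

Lemma cvg_ccvg (T : Type) (F : set_system T) (FF : Filter F) (h : T -> R[i]) l :
  h @ F --> l -> ccvg F h l.
Proof.
move=> hl; split.
  exact: (cvg_comp h Re hl (@Re_continuous l)).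
exact: (cvg_comp h Im hl (@Im_continuous l)).
Qed.

Definition ccontinuous_on c d h := forall s, s \in `[c, d] ->
  ccvg (within `[c, d] (nbhs s)) h (h s).

Lemma within_ccontinuous c d h : {within `[c, d], continuous h} -> ccontinuous_on c d h.
Proof. by move=> /subspace_continuousP ch s scd; apply: cvg_ccvg; exact: ch. Qed.

Lemma ccontinuous_within c d h : ccontinuous_on c d h ->
  {within `[c, d], continuous (fun s => Re (h s))} /\
  {within `[c, d], continuous (fun s => Im (h s))}.
Proof.
by move=> ch; split; apply/subspace_continuousP => s scd; case: (ch s scd).
Qed.

Lemma ccontinuous_subset a b c d h : a <= c -> d <= b ->
  ccontinuous_on a b h -> ccontinuous_on c d h.
Proof.
move=> ac db ch s; rewrite in_itv /= => /andP[cs sd].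
have [|hr hi] := ch s; first by rewrite in_itv /= (le_trans ac cs) (le_trans sd db).
have sub : within `[c, d] (nbhs s) `=>` within `[a, b] (nbhs s).
  apply: within_subset => x /=; rewrite !in_itv /= => /andP[cx xd].
  by rewrite (le_trans ac cx) (le_trans xd db).
by split; [apply: cvg_trans hr|apply: cvg_trans hi]; exact: cvg_app.
Qed.

Lemma smooth_arc_cderive c d g v s : s \in `]c, d[ ->
  derivable (Re \o g) s 1 -> derivable (Im \o g) s 1 -> velocity g s = v s ->
  cderive g s (v s).
Proof.
move=> _ dr di <-; rewrite /velocity /cderive /= !derive1E.
by split; [exact: (DeriveDef dr erefl)|exact: (DeriveDef di erefl)].
Qed.

Definition velocity_integrable c d h g :=
  integrable_on c d (fun s => Re (h s * velocity g s)) /\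
  integrable_on c d (fun s => Im (h s * velocity g s)).

Lemma smooth_arc_integrable c d h g : c < d -> smooth_arc c d g ->
  ccontinuous_on c d h -> velocity_integrable c d h g.
Proof.
move=> cd [v [cv _ gv]] ch.
have cw : ccontinuous_on c d (fun s => h s * v s).
  by move=> s scd; apply: ccvgM; [exact: ch|exact: within_ccontinuous].
have [cr ci] := ccontinuous_within cw.
by split; [case: (integrable_on_interior (k := fun s => Re (h s * velocity g s)) cd cr)|
  case: (integrable_on_interior (k := fun s => Im (h s * velocity g s)) cd ci)] => // s scd;
  have [_ _ ->] := gv s scd.
Qed.

Lemma smooth_arc_FTC c d f g : c < d -> smooth_arc c d g -> ccontinuous_on c d g ->
  (forall s, s \in `[c, d] -> regular f (g s)) ->
  let k s := rat_eval (derive_frac f) (g s) * velocity g s in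
  \int[mu]_(s in `[c, d]) Re (k s) = Re (rat_eval f (g d)) - Re (rat_eval f (g c)) /\
  \int[mu]_(s in `[c, d]) Im (k s) = Im (rat_eval f (g d)) - Im (rat_eval f (g c)).
Proof.
move=> cd [v [cv _ gv]] cg fg k.
pose w s := rat_eval (derive_frac f) (g s) * v s.
have cw : ccontinuous_on c d w.
  move=> s scd; apply: ccvgM; last exact: within_ccontinuous.
  by apply: ccvg_rat (cg s scd); apply: regular_derive; exact: fg.
have [wr wi] := ccontinuous_within cw.
have cf : ccontinuous_on c d (fun s => rat_eval f (g s)).
  by move=> s scd; apply: ccvg_rat (cg s scd); exact: fg.
have [fr fi] := ccontinuous_within cf.
have dfw s : s \in `]c, d[ -> cderive (fun s => rat_eval f (g s)) s (w s).
  move=> scd; apply: cderive_rat; first by apply: fg; exact: subset_itv_oo_cc.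
  have [dr di vE] := gv s scd.
  exact: (smooth_arc_cderive scd dr di vE).
have kw s : s \in `]c, d[ -> k s = w s by move=> scd; have [_ _ vE] := gv s scd; rewrite /k vE.
have [|_ ->] := integrable_on_interior (k := fun s => Re (k s)) cd wr.
  by move=> s scd; rewrite kw.
have [|_ ->] := integrable_on_interior (k := fun s => Im (k s)) cd wi.
  by move=> s scd; rewrite kw.
have ftc (F u : R -> R) : {within `[c, d], continuous u} ->
    {within `[c, d], continuous F} -> (forall s, s \in `]c, d[ -> is_derive s 1 F (u s)) ->
    \int[mu]_(s in `[c, d]) u s = F d - F c.
  move=> cu cF dF; rewrite /Rintegral (continuous_FTC2 (F := F) cd cu) //.
    have [_ Fc Fd] := (continuous_within_itvP _ cd).1 cF.
    by split => // s scd; have [] := dF s scd.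
  by move=> s scd; rewrite derive1E; have [_ ->] := dF s scd.
split.
  by apply: (ftc (fun s => Re (rat_eval f (g s))) _ wr fr) => s /dfw[].
by apply: (ftc (fun s => Im (rat_eval f (g s))) _ wi fi) => s /dfw[].
Qed.

End CurveIntegrals.

(** * The integral along the whole curve as a bounded linear functional *)

Section CurveFunctional.
Variable R : realType.
Local Notation Re := (@complex.Re R).
Local Notation Im := (@complex.Im R).
Local Notation mu := (@lebesgue_measure R).
Local Notation normc := (@Normc.normc R).
Implicit Types (c d e s : R) (h k : R -> R[i]) (z : R[i]).

Lemma normc_ge_ReR z : `|Re z| <= normc z.
Proof. by case: z => x y /=; rewrite -sqrtr_sqr ler_wsqrtr // lerDl sqr_ge0. Qed.

Lemma normc_ge_ImR z : `|Im z| <= normc z.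
Proof. by case: z => x y /=; rewrite -sqrtr_sqr ler_wsqrtr // lerDr sqr_ge0. Qed.

Lemma normc_le_ReIm z : normc z <= `|Re z| + `|Im z|.
Proof.
case: z => x y /=; rewrite -[X in _ <= X]ger0_norm ?addr_ge0 // -sqrtr_sqr.
apply: ler_wsqrtr; rewrite sqrrD !real_normK ?num_real //.
by rewrite lerD2r lerDl mulrn_wge0 // mulr_ge0.
Qed.

Lemma integrable_onZ c d (u : R -> R) r :
  integrable_on c d u -> integrable_on c d (fun s => r * u s).
Proof. by move=> iu; apply: (integrableZl _ r iu). Qed.

(** Induction along the partition: what holds on smooth arcs and passes to concatenations holds on
    the curve. *)
Lemma piecewise_smooth_ind a b g (Q : R -> R -> Prop) :
  (forall c d e, c < d -> d < e -> Q c d -> Q d e -> Q c e) ->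
  (forall c d, a <= c -> c < d -> d <= b -> smooth_arc c d g -> Q c d) ->
  a < b -> piecewise_smooth a b g -> Q a b.
Proof.
move=> Qjoin Qarc ab [_ [x]].
(* The left end is generalized so that the first partition point can be peeled off. *)
suff H y : forall a', a <= a' -> a' < b -> itv_partition a' b y ->
    (forall i, (i < size y)%N -> smooth_arc (nth b (a' :: y) i) (nth b (a' :: y) i.+1) g) ->
    Q a' b by exact: H.
elim: y {x} => [|y x IHx] a' aa' a'b px arcs.
  by move: a'b; rewrite (itv_partition_nil px) ltxx.
have a'y : a' < y by case: px => /andP[].
have px' := itv_partition_cons px.
have yb := itv_partition_le px'.
have Qy : Q a' y by apply: Qarc => //; exact: (arcs 0%N).
move: yb; rewrite le_eqVlt => /predU1P[<-//|yb].
apply: (Qjoin a' y b) => //; apply: IHx => // [|i ix].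
  exact: le_trans (ltW a'y).
exact: (arcs i.+1).
Qed.

Variables (a b : R) (g : R -> R[i]).
Hypotheses (ab : a < b) (g_smooth : piecewise_smooth a b g).

Lemma curve_ccontinuous : ccontinuous_on a b g.
Proof. by case: g_smooth => cg _; exact: within_ccontinuous. Qed.

Lemma curve_integrable h : ccontinuous_on a b h -> velocity_integrable a b h g.
Proof.
move=> ch.
apply: (piecewise_smooth_ind (Q := fun c d => velocity_integrable c d h g)) g_smooth => //.
  move=> c d e cd de [r1 i1] [r2 i2].
  by split; [case: (integrable_on_join (ltW cd) (ltW de) r1 r2)|
             case: (integrable_on_join (ltW cd) (ltW de) i1 i2)].
move=> c d ac cd db arc; apply: smooth_arc_integrable => //.
exact: ccontinuous_subset ch.
Qed.

(** The integrand depends on the parameter; for [h = F \o g] this is [curve_integral] by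
    conversion. *)
Definition path_integral h : R[i] :=
  (\int[mu]_(s in `[a, b]) Re (h s * velocity g s)) +i*
  (\int[mu]_(s in `[a, b]) Im (h s * velocity g s)).

Lemma eq_path_integral h k : {in `[a, b], h =1 k} -> path_integral h = path_integral k.
Proof.
move=> hk; rewrite /path_integral; congr (_ +i* _); apply: eq_Rintegral => s;
  by rewrite inE /= => /hk ->.
Qed.

Lemma path_integralD h k : ccontinuous_on a b h -> ccontinuous_on a b k ->
  path_integral (fun s => h s + k s) = path_integral h + path_integral k.
Proof.
move=> /curve_integrable[hr hi] /curve_integrable[kr ki].
apply: complex_eqP; rewrite (cReD, cImD) /= -RintegralD //; apply: eq_Rintegral => s _;
  by rewrite mulrDl (cReD, cImD).
Qed.

Lemma path_integralZ z h : ccontinuous_on a b h ->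
  path_integral (fun s => z * h s) = z * path_integral h.
Proof.
move=> /curve_integrable[hr hi].
apply: complex_eqP.
  rewrite cReM /= -!RintegralZl // -RintegralB //; try exact: integrable_onZ.
  by apply: eq_Rintegral => s _; rewrite -mulrA cReM.
rewrite cImM /= -!RintegralZl // -RintegralD //; try exact: integrable_onZ.
by apply: eq_Rintegral => s _; rewrite -mulrA cImM.
Qed.

Lemma path_integral_FTC (f : {fraction {poly R[i]}}) :
  (forall s, s \in `[a, b] -> regular f (g s)) ->
  path_integral (fun s => rat_eval (derive_frac f) (g s)) =
  rat_eval f (g b) - rat_eval f (g a).
Proof.
move=> fg; pose k s := rat_eval (derive_frac f) (g s) * velocity g s.
(* Integrability is carried along because additivity of the integral at a join needs it; the end
   values then telescope. *)
pose Q c d := [/\ integrable_on c d (fun s => Re (k s)), integrable_on c d (fun s => Im (k s)),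
  \int[mu]_(s in `[c, d]) Re (k s) = Re (rat_eval f (g d)) - Re (rat_eval f (g c)) &
  \int[mu]_(s in `[c, d]) Im (k s) = Im (rat_eval f (g d)) - Im (rat_eval f (g c))].
have cg := curve_ccontinuous.
suff [_ _ r i] : Q a b by apply: complex_eqP; rewrite (cReD, cImD) (cReN, cImN).
apply: piecewise_smooth_ind g_smooth => // [c d e cd de|c d ac cd db arc].
  move=> [r1 i1 R1 I1] [r2 i2 R2 I2].
  have [r rE] := integrable_on_join (ltW cd) (ltW de) r1 r2.
  have [i iE] := integrable_on_join (ltW cd) (ltW de) i1 i2.
  by split=> //; rewrite ?rE ?iE ?R1 ?R2 ?I1 ?I2 addrC addrA subrK.
have fg' s : s \in `[c, d] -> regular f (g s).
  rewrite in_itv /= => /andP[cs sd]; apply: fg.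
  by rewrite in_itv /= (le_trans ac cs) (le_trans sd db).
have cg' : ccontinuous_on c d g by exact: ccontinuous_subset cg.
have [R1 I1] := smooth_arc_FTC cd arc cg' fg'.
have [|r1 i1] := smooth_arc_integrable (h := fun s => rat_eval (derive_frac f) (g s)) cd arc.
  by move=> s scd; apply: ccvg_rat (cg' s scd); apply: regular_derive; exact: fg'.
by split.
Qed.

(** The squared modulus is a continuous real function, so it attains a maximum. *)
Lemma ccontinuous_bounded h : ccontinuous_on a b h ->
  exists M : R, forall s, s \in `[a, b] -> normc (h s) <= M.
Proof.
move=> /ccontinuous_within[hr hi].
have cN : {within `[a, b], continuous (fun s => Re (h s) ^+ 2 + Im (h s) ^+ 2)}.
  move=> s; apply: cvgD; [exact: (cvgM (hr s) (hr s))|exact: (cvgM (hi s) (hi s))].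
have [c _ cmax] := EVT_max (ltW ab) cN.
exists (Num.sqrt (Re (h c) ^+ 2 + Im (h c) ^+ 2)) => s /cmax.
by case: (h s) => x y /=; exact: ler_wsqrtr.
Qed.

Lemma path_integral_bounded : exists2 V : R, 0 <= V & forall h (M : R),
  ccontinuous_on a b h -> (forall s, s \in `[a, b] -> normc (h s) <= M) ->
  normc (path_integral h) <= M * V.
Proof.
have [|vr vi] := @curve_integrable (fun=> 1); first by move=> s _; exact: ccvg_cst.
pose v s := `|Re (1 * velocity g s)| + `|Im (1 * velocity g s)|.
have iv : integrable_on a b v.
  have nr : integrable_on a b (fun s => `|Re (1 * velocity g s)|).
    exact: (integrable_norm vr).
  have ni : integrable_on a b (fun s => `|Im (1 * velocity g s)|).
    exact: (integrable_norm vi).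
  have := integrableD _ nr ni => /(_ (measurable_itv _)).
  by apply: eq_integrable => // s _; rewrite /v /= EFinD.
have v0 : 0 <= \int[mu]_(s in `[a, b]) v s.
  by apply: Rintegral_ge0 => s _; rewrite addr_ge0.
(* The factor 2 comes from bounding the real and the imaginary part separately. *)
exists (2 * \int[mu]_(s in `[a, b]) v s); first by rewrite mulr_ge0.
move=> h M ch hM; have [hr hi] := curve_integrable ch.
have le1 (u : R -> R) : integrable_on a b u ->
    (forall s, s \in `[a, b] -> `|u s| <= M * v s) ->
    `|\int[mu]_(s in `[a, b]) u s| <= M * \int[mu]_(s in `[a, b]) v s.
  move=> iu uM; apply: le_trans (le_normr_Rintegral _ iu) _ => //.
  rewrite -RintegralZl //; apply: le_Rintegral => //.
  - exact: integrable_norm.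
  - exact: integrable_onZ.
apply: le_trans (normc_le_ReIm _) _; rewrite /path_integral /=.
have -> : M * (2 * \int[mu]_(s in `[a, b]) v s) =
  M * \int[mu]_(s in `[a, b]) v s + M * \int[mu]_(s in `[a, b]) v s by ring.
have vM s : s \in `[a, b] -> normc (h s * velocity g s) <= M * v s.
  move=> sab; rewrite Normc.normcM /v mul1r; apply: ler_pM => //.
  - by case: (h s) => ? ? /=; rewrite sqrtr_ge0.
  - by case: (velocity g s) => ? ? /=; rewrite sqrtr_ge0.
  - exact: hM.
  - exact: normc_le_ReIm.
apply: lerD; apply: le1 => // s sab; apply: le_trans (vM s sab).
  exact: normc_ge_ReR.
exact: normc_ge_ImR.
Qed.

End CurveFunctional.

(** * The Cauchy transform near infinity *)

Section Decay.
Variable R : realType.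
Local Notation normc := (@Normc.normc R).
Implicit Types (u : nat -> R[i]) (p : {poly R[i]}) (z c : R[i]).

Lemma normc_ge0 z : 0 <= normc z.
Proof. by case: z => x y /=; rewrite sqrtr_ge0. Qed.

Lemma ler_normcD (z c : R[i]) : normc (z + c) <= normc z + normc c.
Proof. exact: le_normcD. Qed.

Lemma normc_nat n : normc n%:R = n%:R.
Proof.
have -> : n%:R = (n%:R : R)%:C :> R[i] by rewrite rmorph_nat.
by rewrite /= expr0n /= addr0 sqrtr_sqr ger0_norm.
Qed.

(** Decay is tested along the integers only, which suffices to detect polynomials. *)
Definition decays u := forall e : R, 0 < e ->
  exists N, forall n, (N <= n)%N -> normc (u n) <= e.

Lemma decays_cst c : decays (fun=> c) -> c = 0.
Proof.
move=> cd; apply: (@Normc.eq0_normc R); apply/eqP; rewrite eq_le normc_ge0 andbT.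
by apply/ler_addgt0Pl => e e0; have [N /(_ N (leqnn N))] := cd e e0; rewrite addr0.
Qed.

Lemma nat_gt (x : R) : exists n : nat, x < n%:R.
Proof.
by exists (Num.bound `|x|); exact: le_lt_trans (ler_norm x) (archi_boundP (normr_ge0 x)).
Qed.

Lemma decays_poly p : decays (fun n => p.[n%:R]) -> p = 0.
Proof.
elim/poly_ind: p => [//|p c IHp] pd.
(* If [p * 'X + c] decays, then [p] at [n], being its value minus [c] divided by [n], decays as
   well. *)
have p0 : p = 0.
  apply: IHp => e e0; have [N HN] := pd 1 ltr01.
  have [m mP] := nat_gt ((1 + normc c) / e).
  exists (maxn N m.+1) => n; rewrite geq_max => /andP[Nn mn].
  have n0 : 0 < n%:R :> R by rewrite ltr0n (leq_ltn_trans _ mn).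
  rewrite -(ler_pM2r n0) -[X in _ * X <= _]normc_nat -Normc.normcM.
  apply: (@le_trans _ _ (1 + normc c)).
    have -> : p.[n%:R] * n%:R = (p * 'X + c%:P).[n%:R] + - c.
      by rewrite hornerMXaddC addrK.
    apply: le_trans (ler_normcD _ _) _; apply: lerD; first exact: HN.
    by rewrite normcN.
  rewrite mulrC -ler_pdivrMr //; apply: ltW; apply: lt_trans mP _.
  by rewrite ltr_nat.
rewrite p0 mul0r add0r; congr (_%:P); apply: decays_cst => e e0.
have [N HN] := pd e e0; exists N => n /HN.
by rewrite p0 mul0r add0r hornerC.
Qed.

End Decay.

(** * Moments and Cauchy transform of a rational function on the curve *)

Section CauchyTransform.
Variables (R : realType) (a b : R) (g : R -> R[i]) (P : {fraction {poly R[i]}}).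
Hypotheses (ab : a < b) (g_smooth : piecewise_smooth a b g).
Hypothesis P_regular : forall s, s \in `[a, b] -> regular P (g s).
Local Notation normc := (@Normc.normc R).
Implicit Types (f : {fraction {poly R[i]}}) (t c : R[i]) (B : {poly R[i]}).

Definition regular_on_curve f := forall s, s \in `[a, b] -> regular f (g s).

Lemma regular_off_poles_on_curve f : regular_off_poles P f -> regular_on_curve f.
Proof. by move=> hf s /P_regular; exact: hf. Qed.

Definition moment f := path_integral a b g (fun s => rat_eval f (g s)).

Lemma ccontinuous_rat f : regular_on_curve f ->
  ccontinuous_on a b (fun s => rat_eval f (g s)).
Proof.
move=> fg s sab; apply: ccvg_rat; first exact: fg.
exact: (curve_ccontinuous g_smooth).
Qed.

Lemma momentD f f' : regular_on_curve f -> regular_on_curve f' ->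
  moment (f + f') = moment f + moment f'.
Proof.
move=> hf hf'; rewrite /moment -path_integralD //; try exact: ccontinuous_rat.
by apply: eq_path_integral => s sab; rewrite rat_evalD ?hf ?hf'.
Qed.

Lemma momentZ c f : regular_on_curve f -> moment (const_frac c * f) = c * moment f.
Proof.
move=> hf; rewrite /moment -path_integralZ //; last exact: ccontinuous_rat.
apply: eq_path_integral => s sab.
by rewrite (rat_evalM (regular_poly _ _) (hf s sab)) rat_eval_poly hornerC.
Qed.

(** The Cauchy transform without the factor of [I_infty]. *)
Definition transform f t :=
  path_integral a b g (fun s => rat_eval f (g s) / (rat_eval P (g s) - t)).

Lemma curve_bound : exists2 rho : R, 0 <= rho &
  forall s, s \in `[a, b] -> normc (rat_eval P (g s)) <= rho.
Proof.
have [M MP] := ccontinuous_bounded ab (ccontinuous_rat P_regular).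
exists M => //; apply: le_trans (normc_ge0 _) (MP a _).
by rewrite in_itv /= lexx ltW.
Qed.

Variable rho : R.
Hypothesis rhoP : forall s, s \in `[a, b] -> normc (rat_eval P (g s)) <= rho.

Lemma P_neq t s : rho < normc t -> s \in `[a, b] -> rat_eval P (g s) - t != 0.
Proof.
move=> rt sab; rewrite subr_eq0; apply/eqP => Pt.
by move: rt; rewrite -Pt ltNge rhoP.
Qed.

Lemma ccontinuous_transform f t : rho < normc t -> regular_on_curve f ->
  ccontinuous_on a b (fun s => rat_eval f (g s) / (rat_eval P (g s) - t)).
Proof.
move=> rt hf s sab; apply: ccvgM; first exact: ccontinuous_rat.
apply: ccvgV; first exact: P_neq.
by apply: ccvgD; [exact: ccontinuous_rat|exact: ccvg_cst].
Qed.

Lemma transformD f f' t : rho < normc t -> regular_on_curve f -> regular_on_curve f' ->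
  transform (f + f') t = transform f t + transform f' t.
Proof.
move=> rt hf hf'; rewrite /transform -path_integralD //; try exact: ccontinuous_transform.
by apply: eq_path_integral => s sab; rewrite rat_evalD ?hf ?hf' // mulrDl.
Qed.

Lemma transformZ c f t : rho < normc t -> regular_on_curve f ->
  transform (const_frac c * f) t = c * transform f t.
Proof.
move=> rt hf; rewrite /transform -path_integralZ //; last exact: ccontinuous_transform.
apply: eq_path_integral => s sab.
by rewrite (rat_evalM (regular_poly _ _) (hf s sab)) rat_eval_poly hornerC -mulrA.
Qed.

(** Pointwise, [P / (P - t) = 1 + t / (P - t)]. *)
Lemma transform_mulP f t : rho < normc t -> regular_on_curve f ->
  transform (P * f) t = moment f + t * transform f t.
Proof.
move=> rt hf; rewrite /transform -path_integralZ //; last exact: ccontinuous_transform.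
rewrite -path_integralD //; last 2 first.
- exact: ccontinuous_rat.
- move=> s sab; apply: ccvgM; first exact: ccvg_cst.
  exact: ccontinuous_transform.
apply: eq_path_integral => s sab.
rewrite (rat_evalM (P_regular sab) (hf s sab)).
move: (P_neq rt sab); move: (rat_eval P _) (rat_eval f _) => x y xt.
by apply: (mulIf xt); rewrite mulrDl -[t * _ * _]mulrA !mulfVK //; ring.
Qed.

(** On the curve [P - n] has modulus at least [n - rho], so the transform is at most
    [M * V / (n - rho)]. *)
Lemma transform_decays f : regular_on_curve f -> decays (fun n => transform f n%:R).
Proof.
move=> hf e e0; have [V V0 VP] := path_integral_bounded ab g_smooth.
have [M MP] := ccontinuous_bounded ab (ccontinuous_rat hf).
have M0 : 0 <= M.
  by apply: le_trans (normc_ge0 _) (MP a _); rewrite in_itv /= lexx ltW.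
have [N NP] := nat_gt (rho + M * V / e + 1).
have rN n : (N <= n)%N -> rho + M * V / e + 1 < n%:R.
  by move=> Nn; apply: lt_le_trans NP _; rewrite ler_nat.
have MVe : 0 <= M * V / e by rewrite divr_ge0 ?mulr_ge0 // ltW.
exists N => n /rN {}rN.
have rn : rho < normc n%:R by rewrite normc_nat; lra.
have nr : 0 < n%:R - rho by rewrite subr_gt0 -normc_nat.
apply: le_trans (VP _ (M / (n%:R - rho)) (ccontinuous_transform rn hf) _) _.
  move=> s sab; rewrite Normc.normcM Normc.normcV; apply: ler_pM.
  - exact: normc_ge0.
  - by rewrite invr_ge0 normc_ge0.
  - exact: MP.
  have le : n%:R - rho <= normc (rat_eval P (g s) - n%:R).
    rewrite lerBlDr -(normc_nat _ n).
    have -> : n%:R = - (rat_eval P (g s) - n%:R) + rat_eval P (g s) :> R[i] by ring.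
    apply: le_trans (ler_normcD _ _) _; rewrite normcN.
    by rewrite opprB addrNK lerD2l; exact: rhoP.
  by rewrite lef_pV2 // posrE // (lt_le_trans nr).
rewrite mulrAC ler_pdivrMr // [e * _]mulrC -ler_pdivrMr //.
move: rN; set x := M * V / e; lra.
Qed.

Let hX i : regular_on_curve (P ^+ i).
Proof. by move=> s /P_regular; exact: regularX. Qed.

Let hB B : regular_on_curve (poly_at P B).
Proof. by move=> s /P_regular; exact: poly_at_regular. Qed.

Let hM f f' : regular_on_curve f -> regular_on_curve f' -> regular_on_curve (f * f').
Proof. by move=> hf hf' s sab; apply: regularM; [exact: hf|exact: hf']. Qed.

Lemma moment_poly_at f B : regular_on_curve f -> (forall i, moment (P ^+ i * f) = 0) ->
  moment (poly_at P B * f) = 0.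
Proof.
move=> hf mf; suff H i : moment (P ^+ i * (poly_at P B * f)) = 0.
  by have := H 0%N; rewrite expr0 mul1r.
elim/poly_ind: B i => [|B c IHB] i.
  have -> : P ^+ i * (poly_at P 0 * f) = const_frac 0 * f.
    by rewrite poly_at0 /const_frac tofrac0 !mul0r mulr0.
  by rewrite momentZ // mul0r.
have -> : P ^+ i * (poly_at P (B * 'X + c%:P) * f) =
    P ^+ i.+1 * (poly_at P B * f) + const_frac c * (P ^+ i * f).
  by rewrite poly_atD poly_atM poly_atX poly_atC exprS; ring.
rewrite momentD; first by rewrite IHB momentZ ?mf ?mulr0 ?addr0 //; exact: hM.
  by apply: hM => //; exact: hM.
by apply: hM; [move=> s _; exact: regular_poly|exact: hM].
Qed.

(* [(B(t) - B(P)) / (P - t)] is polynomial in [P] and [t]. *)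
Lemma transform_poly_at f B : regular_on_curve f -> exists p : {poly R[i]},
  (forall t, rho < normc t -> B.[t] * transform f t = transform (poly_at P B * f) t + p.[t]) /\
  ((forall i, moment (P ^+ i * f) = 0) -> p = 0).
Proof.
move=> hf; elim/poly_ind: B => [|B c [p [pE p0]]].
  exists 0; split => // t rt; rewrite !horner0 mul0r addr0.
  have -> : poly_at P 0 * f = const_frac 0 * f by rewrite poly_at0 /const_frac tofrac0.
  by rewrite transformZ // mul0r.
(* By [transform_mulP], multiplying the identity for [B] by [t] produces the transform for [B * 'X]
   minus a moment. *)
exists (p * 'X - (moment (poly_at P B * f))%:P); split => [t rt|mf]; last first.
  by rewrite p0 // moment_poly_at // mul0r subrr.
have -> : poly_at P (B * 'X + c%:P) * f = P * (poly_at P B * f) + const_frac c * f.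
  by rewrite poly_atD poly_atM poly_atX poly_atC; ring.
have hBf : regular_on_curve (poly_at P B * f) by exact: hM.
rewrite transformD //; last 2 first.
- exact: hM.
- by apply: hM => // s _; exact: regular_poly.
rewrite transform_mulP // transformZ // hornerMXaddC hornerD hornerN hornerC hornerMX.
move: (pE t rt); move: (transform f t) (transform _ t) (moment _) B.[t] p.[t].
by move=> T T' m x y e; rewrite mulrDl mulrAC e; ring.
Qed.

(** If the transform of [f] is zero at large integers, that of [P * f] is there the constant
    [moment f]; it decays, so both are zero and the argument repeats with [P * f]. *)
Lemma moments_eq0 f : regular_on_curve f ->
  (forall n, rho < n%:R -> transform f n%:R = 0) -> forall i, moment (P ^+ i * f) = 0.
Proof.
move=> hf tf; have [N NP] := nat_gt rho.
have step f' : regular_on_curve f' -> (forall n, rho < n%:R -> transform f' n%:R = 0) ->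
    moment f' = 0 /\ (forall n, rho < n%:R -> transform (P * f') n%:R = 0).
  move=> hf' tf'.
  have tE n : rho < n%:R -> transform (P * f') n%:R = moment f'.
    by move=> rn; rewrite transform_mulP ?normc_nat // tf' // mulr0 addr0.
  have m0 : moment f' = 0.
    apply: (@decays_cst R) => e e0.
    have [M MP] := transform_decays (hM P_regular hf') e0.
    exists (maxn N M) => n; rewrite geq_max => /andP[Nn /MP].
    have rn : rho < n%:R by apply: lt_le_trans NP _; rewrite ler_nat.
    by rewrite (tE n rn).
  by split=> [|n rn]; [exact: m0|rewrite (tE n rn)].
suff H i : forall n, rho < n%:R -> transform (P ^+ i * f) n%:R = 0.
  by move=> i; have [] := step (P ^+ i * f) (hM (hX i) hf) (H i).
elim: i => [|i IHi]; first by rewrite expr0 mul1r.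
have [_] := step (P ^+ i * f) (hM (hX i) hf) IHi.
by rewrite exprS mulrA.
Qed.

End CauchyTransform.

(** * The unbounded component *)

Section ExteriorOfCurve.
Variables (R : realType) (P : {fraction {poly R[i]}}) (a b : R) (g : R -> R[i]).
Local Notation normc := (@Normc.normc R).
Local Notation Re := (@complex.Re R).
Local Notation Im := (@complex.Im R).
Hypothesis P_regular : forall s, s \in `[a, b] -> regular P (g s).
Variable rho : R.
Hypothesis rhoP : forall s, s \in `[a, b] -> normc (rat_eval P (g s)) <= rho.
Hypothesis rho0 : 0 <= rho.

(** The ray from [t] away from the origin, without its limit point at infinity. *)
Let ray (t : R[i]) : set (one_point_compactification R[i]) :=
  [set Some (s%:C * t) | s in `[1, +oo[].

Let normc_ray (s : R) t : 0 <= s -> normc (s%:C * t) = s * normc t.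
Proof.
move=> s0; rewrite Normc.normcM; congr (_ * _).
by rewrite /= expr0n /= addr0 sqrtr_sqr ger0_norm.
Qed.

Let ray_connected t : connected (ray t).
Proof.
apply: connected_continuous_connected.
  by apply/connected_intervalP; exact: interval_is_interval.
apply: continuous_subspaceT => s.
apply: continuous_comp; last exact: one_point_compactification_some_continuous.
apply/(@cvgrPdist_lt _ _ _ _ (nbhs_filter s)) => e e0.
have eE : e = (Re e)%:C.
  by case: e e0 => x y; rewrite ltcE /= => /andP[/eqP -> _].
have e0' : 0 < Re e by rewrite -ltcR -eE.
have nt : 0 < 1 + normc t by rewrite ltr_wpDr // normc_ge0.
near=> s'.
rewrite -mulrBl -rmorphB /= normrM.
have -> : `|t| = (normc t)%:C by [].
have -> : `|(s - s')%:C| = `|s - s'|%:C.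
  by rewrite -[LHS]/((normc _)%:C) /= expr0n /= addr0 sqrtr_sqr.
rewrite -rmorphM /= eE ltcR.
apply: (@le_lt_trans _ _ (`|s - s'| * (1 + normc t))).
  by rewrite ler_wpM2l // lerDr.
rewrite -ltr_pdivlMr //.
by near: s'; apply: cvgr_dist_lt => //; rewrite divr_gt0.
Unshelve. all: by end_near. Qed.

(** A basic neighbourhood of infinity is the complement of a compact set, on which the squared
    modulus is bounded. *)
Let ray_closure t : t != 0 -> closure (ray t) None.
Proof.
move=> t0 B [W [cW _] WB].
pose N (z : R[i]) := Re z ^+ 2 + Im z ^+ 2.
have NE z : N z = normc z ^+ 2.
  by rewrite /N; case: z => x y /=; rewrite sqr_sqrtr // addr_ge0 // sqr_ge0.
have cN : continuous N.
  move=> z.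
  have hr : (fun y : R[i] => Re y) @ z --> Re z := @Re_continuous R z.
  have hi : (fun y : R[i] => Im y) @ z --> Im z := @Im_continuous R z.
  exact: cvgD (cvgM hr hr) (cvgM hi hi).
have : compact (N @` W) by apply: continuous_compact cW; exact: continuous_subspaceT.
move=> /compact_bounded[M [_ MP]].
have n0 : 0 < normc t.
  by rewrite lt_def normc_ge0 andbT; apply: contra_neq t0; exact: Normc.eq0_normc.
(* With this [s], [s * normc t ^+ 2] exceeds [|M| + 1], and [s >= 1] gives the same for the squared
   modulus of [s * t]. *)
pose s := 1 + (`|M| + 1) / normc t ^+ 2.
have s1 : 1 <= s by rewrite /s lerDl divr_ge0 // ?addr_ge0 // sqr_ge0.
exists (Some (s%:C * t)); split; first by exists s => //=; rewrite in_itv /= s1.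
apply: WB; left; exists (s%:C * t) => // Wst.
have M1 : M < `|M| + 1 by rewrite (le_lt_trans (ler_norm M)) // ltrDl.
have /= := MP _ M1 (N (s%:C * t)) (ex_intro2 _ _ _ Wst erefl).
rewrite NE normc_ray ?(le_trans _ s1) // ger0_norm ?sqr_ge0 // leNgt => /negP; apply.
rewrite exprMn; apply: (@lt_le_trans _ _ (s * normc t ^+ 2)).
  by rewrite /s mulrDl mul1r divfK ?expf_neq0 ?gt_eqF // ltrDr exprn_gt0.
by rewrite ler_pM2r ?exprn_gt0 // expr2 ler_peMl // (le_trans _ s1).
Qed.

(** The ray from [t] together with infinity is connected, and it avoids the image of the curve
    because its moduli exceed [rho]. *)
Lemma U_infty_far t : rho < normc t -> U_infty P a b g (Some t).
Proof.
move=> rt; have t0 : t != 0.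
  apply: contraTneq rt => ->; rewrite -leNgt.
  by rewrite (_ : normc 0 = 0) // /= expr0n /= addr0 sqrtr0.
pose S := ray t `|` [set None].
suff [cS SA] : connected S /\
    S `<=` ~` [set rat_ext P (Some (g s)) | s in `[a, b]].
  apply: (connected_component_max (B := S)) => //; first by right.
  by left; exists 1; [rewrite /= in_itv /= lexx|rewrite rmorph1 mul1r].
split; last first.
  move=> _ [[s /= s1 <-]|->] [u uab]; rewrite /= (negbTE (P_regular uab)) // => -[e].
  move: s1; rewrite in_itv /= andbT => s1.
  have := rhoP uab; rewrite e normc_ray ?(le_trans _ s1) // leNgt => /negP; apply.
  by apply: lt_le_trans rt _; rewrite ler_peMl // normc_ge0.
apply/connectedP => E [E0 SE sep].
have rE : ray t `<=` E false `|` E true by rewrite -SE; exact: subsetUl.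
(* In a separation the ray lies in one half; infinity is in the closure of that half, so nothing is
   left for the other. *)
have [b' [rb E1]] : exists b', ray t `<=` E b' /\ closure (E b') `&` E (~~ b') = set0.
  case: sep => sep1 sep2; case: (connected_subset (conj sep1 sep2) rE (@ray_connected t)) => h.
    by exists false.
  by exists true; split=> //; rewrite setIC.
have [x Ex] := E0 (~~ b').
have xS : S x by rewrite SE; case: b' Ex {rb E1} => /= Ex; [left|right].
have cx : closure (E b') x.
  case: xS => [rx|->]; first by apply: subset_closure; exact: rb.
  by apply: (closureS rb); exact: ray_closure.
by have : set0 x by rewrite -E1.
Qed.

End ExteriorOfCurve.

(** * From rationality of the Cauchy transform to its vanishing *)

Lemma rat_ext_rnum0 (K : fieldType) (r : {fraction {poly K}}) z :
  rnum r = 0 -> rat_ext r z = None \/ rat_ext r z = Some 0.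
Proof.
move=> r0; case: z => [x|] /=; rewrite /rat_eval r0.
  by rewrite horner0 mul0r; case: ifP; [left|right].
by rewrite size_poly0 ltn0 coef0 mul0r; right.
Qed.

Theorem theorem3p4 (R : realType) (P q : {fraction {poly R[i]}})
    (a b : R) (g : R -> R[i])
    (P_nonconstant : forall c : R[i], P <> c%:P%:F)
    (q_neq0 : q <> 0)
    (g_curve : is_curve a b g)
    (P_no_pole : forall s, s \in `[a, b] -> rat_ext P (Some (g s)) <> None)
    (q_no_pole : forall s, s \in `[a, b] -> rat_ext q (Some (g s)) <> None)
    (poles_qP : rat_ext q @^-1` [set None] `<=` rat_ext P @^-1` [set None])
    (P_infty : rat_ext P None = None) :
  I_infty_rational P q a b g <->
  (forall t, U_infty P a b g t -> I_infty P q a b g t = 0).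
Proof.
case: g_curve => ab gs _; split=> [[r rI] t Ut|I0]; last first.
  exists 0 => t /I0 ->.
  have r0 : rnum (0 : {fraction {poly R[i]}}) = 0.
    have e : 0 = 0%:F / 1%:F :> {fraction {poly R[i]}} by rewrite tofrac0 mul0r.
    by have := frac_cross (oner_neq0 _) e; rewrite mulr1 mul0r.
  have [] // := rat_ext_rnum0 t r0.
  case: t => [x|] /=; last by rewrite r0 size_poly0 ltn0.
  (* The reduced denominator of 0 is coprime to 0, hence a nonzero constant without roots. *)
  have := coprimep_rnum_rden (0 : {fraction {poly R[i]}}).
  rewrite r0 coprime0p => /eqp_root ->.
  by rewrite rootC oner_eq0.
have Pr s : s \in `[a, b] -> regular P (g s).
  by move=> /P_no_pole /=; rewrite /regular; case: ifP.
have q_off : regular_off_poles P q.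
  move=> x; apply: contraTT; rewrite /regular !negbK => qx.
  by have := @poles_qP (Some x); rewrite /= qx => /(_ erefl); case: ifP.
have P_infty' : (size (rden P) < size (rnum P))%N.
  by move: P_infty => /=; case: ifP.
have qc := regular_off_poles_on_curve Pr q_off.
have [rho rho0 rhoP] := curve_bound ab gs Pr.
set B := rden r; set A := rnum r.
pose J f n := transform a b g P f n%:R.
set k : R[i] := (2 * pi%:C * 'i)^-1.
(* Large integers lie in [U_infty], and a finite value of [rat_ext r] there also says that [B] does
   not vanish. *)
have rIn n : rho < n%:R -> A.[n%:R] = k * (B.[n%:R] * J q n).
  move=> rn; have rn' : rho < Normc.normc (n%:R : R[i]) by rewrite normc_nat.
  have := rI (Some n%:R) (U_infty_far Pr rhoP rho0 rn').
  rewrite /=; case: ifP => // /negbT Bn [].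
  rewrite /rat_eval -/A -/B => e.
  by rewrite mulrCA -[k * J q n]e mulrC divfK.
have [p [pE p0]] := transform_poly_at ab gs Pr rhoP B qc.
have Bqc : regular_on_curve a b g (poly_at P B * q).
  apply: (regular_off_poles_on_curve Pr).
  by apply: regular_off_polesM q_off; exact: regular_off_poles_at.
have An n : rho < n%:R -> (A - k *: p).[n%:R] = k * J (poly_at P B * q) n.
  move=> rn; rewrite !hornerE rIn // pE ?normc_nat //.
  by rewrite mulrDr addrK.
have Jd := transform_decays ab gs Pr rhoP Bqc.
(* The polynomial [A - k *: p] agrees with a decaying transform at large integers, so both are zero
   there. *)
have AE : A = k *: p.
  apply/eqP; rewrite -subr_eq0; apply/eqP/decays_poly => e e0.
  have k0 : 0 < 1 + Normc.normc k by rewrite ltr_wpDr // normc_ge0.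
  have [N NP] := Jd (e / (1 + Normc.normc k)) (divr_gt0 e0 k0).
  have [M MP] := nat_gt rho.
  exists (maxn N M) => n; rewrite geq_max => /andP[/NP Jn Mn].
  rewrite An; last by apply: lt_le_trans MP _; rewrite ler_nat.
  rewrite Normc.normcM.
  apply: (@le_trans _ _ ((1 + Normc.normc k) * (e / (1 + Normc.normc k)))).
    by apply: ler_pM => //; rewrite ?normc_ge0 // lerDr.
  by rewrite mulrC divfK // gt_eqF.
have k0 : k != 0.
  rewrite invr_eq0; apply: mulf_neq0; last by rewrite eq_complex /= oner_eq0 andbF.
  apply: mulf_neq0; first by rewrite pnatr_eq0.
  by rewrite eq_complex /= gt_eqF // pi_gt0.
have J0 n : rho < n%:R -> J (poly_at P B * q) n = 0.
  move=> rn; have := An n rn; rewrite AE subrr horner0 => /esym/eqP.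
  by rewrite mulf_eq0 (negbTE k0) => /eqP.
have Bm := moments_eq0 ab gs Pr rhoP Bqc J0.
have onc := regular_off_poles_on_curve Pr.
have aab : a \in `[a, b] by rewrite in_itv /= lexx ltW.
have bab : b \in `[a, b] by rewrite in_itv /= lexx ltW.
have mq : forall i, moment a b g (P ^+ i * q) = 0.
  apply: (moments_divide P_infty' (Pr a aab) (Pr b bab)
    (fun f h hf hh => momentD ab gs (onc f hf) (onc h hh))
    (fun c f hf => momentZ ab gs c (onc f hf))
    (fun f hf => path_integral_FTC ab gs (onc f hf))
    (rden_neq0 r) q_off Bm).
(* All moments of [q] vanish, so the correction [p] is zero and with it the numerator of [r]. *)
have A0 : rnum r = 0 by rewrite -/A AE p0 // scaler0.
have := rI t Ut; have [->|->] := rat_ext_rnum0 t A0 => // -[<-].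
by [].
Qed.
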